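(* Let $n\ge 3$, $m\ge 1$ and let $g:\overline{\mathbb{B}^n}\to\mathbb{R}^m$ be continuous. If $f:\overline{\mathbb{B}^n}\to\mathbb{R}^m$ is continuous on $\overline{\mathbb{B}^n}$, of class $\mathcal{C}^2$ in $\mathbb{B}^n$, and satisfies $\Delta f=g$ in $\mathbb{B}^n$, then for all $x\in\overline{\mathbb{B}^n}$ $$\left|f(x)-\frac{1-|x|^2}{(1+|x|^2)^{n/2}}\,\mathcal{P}_f(0)\right|\le \|\mathcal{P}_f\|_\infty\,U(|x|N)+\frac{\|g\|_\infty}{2n}(1-|x|^2).$$ Moreover, the inequality is sharp on $\mathbb{S}^{n-1}\cup\{0\}$: for every constant $M>0$, if $g(x)=(-2nM,0,\ldots,0)$ and $f(x)=(M(1-|x|^2),0,\ldots,0)$ for $x\in\overline{\mathbb{B}^n}$, then equality holds for every $x\in\mathbb{S}^{n-1}\cup\{0\}$.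
   Context: $\mathbb{B}^n$ is the open unit ball of $\mathbb{R}^n$, $\mathbb{S}^{n-1}$ the unit sphere, $|\cdot|$ the Euclidean norm, and $d\sigma$ the normalized ($\sigma(\mathbb{S}^{n-1})=1$) Lebesgue surface measure on $\mathbb{S}^{n-1}$. The Laplacian $\Delta f=\sum_{k=1}^n \partial^2 f/\partial x_k^2$ is taken componentwise. The Poisson kernel is $P(x,\zeta)=\frac{1-|x|^2}{|x-\zeta|^n}$ for $x\in\mathbb{B}^n$, $\zeta\in\mathbb{S}^{n-1}$, and for bounded integrable $\psi$ on $\mathbb{S}^{n-1}$, $\mathcal{P}_\psi(x)=\int_{\mathbb{S}^{n-1}}P(x,\zeta)\psi(\zeta)\,d\sigma(\zeta)$, $x\in\mathbb{B}^n$; $\mathcal{P}_f$ denotes $\mathcal{P}_\psi$ with $\psi=f|_{\mathbb{S}^{n-1}}$. For a function $h$ on $\mathbb{B}^n$, $\|h\|_\infty=\sup_{x\in\mathbb{B}^n}|h(x)|$. $N=(0,\ldots,0,1)\in\mathbb{S}^{n-1}$, and $U=\mathcal{P}_{\chi_{S^+}-\chi_{S^-}}$, where $\chi$ denotes indicator functions, $S^+=\{x\in\mathbb{S}^{n-1}:x_n\ge 0\}$ and $S^-=\{x\in\mathbb{S}^{n-1}:x_n\le 0\}$; at the boundary point $N$, $U$ is given its continuous boundary value $U(N)=1$. *)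

(* Defs.v *)
From HB Require Import structures.
From mathcomp Require Import all_boot all_order all_algebra.
From mathcomp Require Import all_classical all_reals all_analysis.
From mathcomp Require Import measurable_realfun.
Set Implicit Arguments.
Unset Strict Implicit.
Unset Printing Implicit Defensive.
Import Order.TTheory GRing.Theory Num.Theory.
Import numFieldNormedType.Exports.
Local Open Scope classical_set_scope.
Local Open Scope ring_scope.

(* The library norm on 'rV[R]_n is the sup norm: it is used only for the
   topology, and the Euclidean norm is [enorm]. *)
Section euclidean_geometry.
Context {R : realType} {n : nat}.

Definition enorm (x : 'rV[R]_n) : R := Num.sqrt (\sum_(i < n) x ord0 i ^+ 2).

Definition eball : set 'rV[R]_n := [set x | enorm x < 1].

Definition ecball : set 'rV[R]_n := [set x | enorm x <= 1].

Definition esphere : set 'rV[R]_n := [set x | enorm x = 1].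

(* (0, ..., 0, 1) *)
Definition north : 'rV[R]_n := \row_(i < n) (i.+1 == n)%:R.

(* (1, 0, ..., 0) *)
Definition first_vec : 'rV[R]_n := \row_(i < n) (i == 0%N :> nat)%:R.

(* The closed hemispheres { x_n >= 0 } and { x_n <= 0 }; [i.+1 = n] selects the
   last coordinate. *)
Definition upper_hemisphere : set 'rV[R]_n :=
  [set x | esphere x /\ forall i : 'I_n, i.+1 = n -> 0 <= x ord0 i].

Definition lower_hemisphere : set 'rV[R]_n :=
  [set x | esphere x /\ forall i : 'I_n, i.+1 = n -> x ord0 i <= 0].

End euclidean_geometry.

Definition supnorm {R : realType} {n m : nat} (h : 'rV[R]_n -> 'rV[R]_m) : R :=
  sup [set enorm (h x) | x in eball].

Section differential_calculus.
Context {R : realType} {n m : nat}.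

Definition partial (i : 'I_n) (f : 'rV[R]_n -> 'rV[R]_m) :
    'rV[R]_n -> 'rV[R]_m :=
  'D_(delta_mx ord0 i) f.

Fixpoint Ck (k : nat) (D : set 'rV[R]_n) (f : 'rV[R]_n -> 'rV[R]_m) : Prop :=
  (forall x, D x -> {for x, continuous f}) /\
  if k is k'.+1 then
    forall i : 'I_n,
      (forall x, D x -> derivable f x (delta_mx ord0 i)) /\
      Ck k' D (partial i f)
  else True.

Definition laplacian (f : 'rV[R]_n -> 'rV[R]_m) (x : 'rV[R]_n) : 'rV[R]_m :=
  \sum_(i < n) partial i (partial i f) x.

End differential_calculus.

Definition measure_row_display : measure_display.
Proof. exact: default_measure_display. Qed.

(* R^n carries the product (= Borel) sigma-algebra, generated by the
   coordinates. *)
Section measurable_row.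
Context {R : realType} (n : nat).

Let coors (i : 'I_n) (x : 'rV[R]_n) : measurableTypeR R := x ord0 i.

Let row_set0 : g_sigma_preimage coors set0.
Proof. exact: sigma_algebra0. Qed.

Let row_setC A : g_sigma_preimage coors A -> g_sigma_preimage coors (~` A).
Proof. exact: sigma_algebraC. Qed.

Let row_bigcup (F : _^nat) : (forall i, g_sigma_preimage coors (F i)) ->
  g_sigma_preimage coors (\bigcup_i (F i)).
Proof. exact: sigma_algebra_bigcup. Qed.

HB.instance Definition _ :=
  @isMeasurable.Build measure_row_display
  'rV[R]_n (g_sigma_preimage coors) row_set0 row_setC row_bigcup.

Lemma measurable_coord (i : 'I_n) :
  measurable_fun [set: 'rV[R]_n] (fun x => x ord0 i : measurableTypeR R).
Proof.
move=> _ Y mY; rewrite setTI; apply: sub_sigma_algebra => /=.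
rewrite -bigcup_seq/=; exists i => /=; first by rewrite mem_index_enum.
by exists Y => //; rewrite setTI.
Qed.

Lemma measurable_fun_rowP d (T : measurableType d) (f : T -> 'rV[R]_n) :
  (forall i, measurable_fun [set: T] (fun t => f t ord0 i : measurableTypeR R)) ->
  measurable_fun [set: T] f.
Proof.
move=> mf _ A mA; rewrite setTI.
suff : g_sigma_preimage (fun i => coors i \o f) `<=` measurable.
  apply; rewrite g_sigma_preimage_comp.
  by exists A => //; rewrite setTI.
apply: smallest_sub; first exact: sigma_algebra_measurable.
elim/big_ind : _ => //; first by move=> U V hU hV B [/hU|/hV].
by move=> i _ B [C mC <-]; exact: mf.
Qed.

End measurable_row.

Section lebesgue_row.
Context {R : realType}.

Definition row_cons n (p : measurableTypeR R * 'rV[R]_n) : 'rV[R]_n.+1 :=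
  \row_(i < n.+1) if unlift ord0 i is Some j then p.2 ord0 j else p.1.

Let row_uncons n (x : 'rV[R]_n.+1) : measurableTypeR R * 'rV[R]_n :=
  (x ord0 ord0, \row_(i < n) x ord0 (lift ord0 i)).

Let row_consK n : cancel (@row_cons n) (@row_uncons n).
Proof.
case=> a v; congr pair; first by rewrite mxE unlift_none.
by apply/rowP => i; rewrite !mxE liftK.
Qed.

Lemma measurable_row_cons n : measurable_fun setT (@row_cons n).
Proof.
apply: measurable_fun_rowP => i.
case: (unliftP ord0 i) => [j ->|->].
  rewrite (_ : (fun t => _) =
    fun t : measurableTypeR R * 'rV[R]_n => t.2 ord0 j); last first.
    by apply/funext => t; rewrite mxE liftK.
  by apply: (measurableT_comp (measurable_coord j)); exact: measurable_snd.
rewrite (_ : (fun t => _) = @fst (measurableTypeR R) 'rV[R]_n); first exact: measurable_fst.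
by apply/funext => t; rewrite mxE unlift_none.
Qed.

Let measurable_row_uncons n : measurable_fun setT (@row_uncons n).
Proof.
apply/measurable_fun_pairP; split; first exact: measurable_coord.
apply: measurable_fun_rowP => i.
rewrite (_ : (fun t => _) =
    fun t : 'rV[R]_n.+1 => t ord0 (lift ord0 i)).
  exact: measurable_coord.
by apply/funext => t; rewrite mxE.
Qed.

(* Lebesgue measure on R^n as the n-fold product of one-dimensional Lebesgue
   measure. *)
Fixpoint lebesgue_row (n : nat) : set 'rV[R]_n -> \bar R :=
  match n with
  | 0%N => \d_(0 : 'rV[R]_0)
  | n'.+1 => pushforward (lebesgue_measure \x @lebesgue_row n')%E (@row_cons n')
  end.

Let lebesgue_row_measure n :
  exists mu : {sigma_finite_measure set 'rV[R]_n -> \bar R},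
    @lebesgue_row n = mu :> (_ -> _).
Proof.
elim: n => [|n [mu IH]]; first by exists (\d_(0 : 'rV[R]_0)).
pose leb : {sigma_finite_measure set (measurableTypeR R) -> \bar R} :=
  @lebesgue_measure R.
pose P : {measure set (measurableTypeR R * 'rV[R]_n)%type -> \bar R} :=
  (leb \x mu)%E.
have mc := @measurable_row_cons n.
pose nu0 := pushforward P (@row_cons n) : {measure set 'rV[R]_n.+1 -> \bar R}.
pose nu := nu0 mc.
have nu_sf : sigma_finite setT nu.
  have /sigma_finiteP[F [TF ndF Foo]] := sigma_finiteT leb.
  have /sigma_finiteP[G [TG ndG Goo]] := sigma_finiteT mu.
  exists (fun k => @row_uncons n @^-1` (F k `*` G k)).
    rewrite -preimage_bigcup (_ : \bigcup_k _ = setT) ?preimage_setT//.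
    rewrite -subTset => -[x y] _.
    have [i _ Fx] : (\bigcup_i F i) x by rewrite -TF.
    have [j _ Gy] : (\bigcup_j G j) y by rewrite -TG.
    exists (maxn i j) => //; split.
      by move: (x) Fx; exact/subsetPset/ndF/leq_maxl.
    by move: (y) Gy; exact/subsetPset/ndG/leq_maxr.
  move=> k; have [mF Fk] := Foo k; have [mG Gk] := Goo k; split.
    rewrite -[X in measurable X]setTI.
    by apply: measurable_row_uncons => //; exact: measurableX.
  rewrite /nu /nu0 /= /pushforward -comp_preimage.
  rewrite (_ : _ \o _ = id); last by apply/funext => p /=; exact: row_consK.
  rewrite preimage_id [X in (X < _)%E]product_measure1E//.
  by rewrite lte_mul_pinfty// ge0_fin_numE.
pose H := Measure_isSigmaFinite.Build _ _ _ nu nu_sf.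
pose nu' : {sigma_finite_measure set 'rV[R]_n.+1 -> \bar R} :=
  HB.pack (Measure.sort nu) H.
by exists nu'; rewrite /= IH.
Qed.

Let lebesgue_row0 n : @lebesgue_row n set0 = 0%E.
Proof. by have [mu ->] := lebesgue_row_measure n; exact: measure0. Qed.

Let lebesgue_row_ge0 n A : (0 <= @lebesgue_row n A)%E.
Proof. by have [mu ->] := lebesgue_row_measure n; exact: measure_ge0. Qed.

Let lebesgue_row_sigma_additive n : semi_sigma_additive (@lebesgue_row n).
Proof.
by have [mu ->] := lebesgue_row_measure n; exact: measure_semi_sigma_additive.
Qed.

HB.instance Definition _ n := isMeasure.Build _ _ _ (@lebesgue_row n)
  (lebesgue_row0 n) (@lebesgue_row_ge0 n) (@lebesgue_row_sigma_additive n).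

Let lebesgue_row_sigma_finite n : sigma_finite setT (@lebesgue_row n).
Proof. by have [mu ->] := lebesgue_row_measure n; exact: sigma_finiteT. Qed.

HB.instance Definition _ n := Measure_isSigmaFinite.Build _ _ _
  (@lebesgue_row n) (@lebesgue_row_sigma_finite n).

End lebesgue_row.
Arguments lebesgue_row {R} n _.

Section sphere_measure.
Context {R : realType} {n : nat}.

Definition radial_proj (y : 'rV[R]_n) : 'rV[R]_n := (enorm y)^-1 *: y.

(* Normalized surface measure on the unit sphere, in polar coordinates: the
   proportion of the volume of the unit ball that lies in the cone
   { y | y / |y| \in A }.  It is a Borel measure on R^n, carried by the sphere
   up to the null set {0}. *)
Definition sphere_measure (A : set 'rV[R]_n) : \bar R :=
  (((fine (lebesgue_row n eball))^-1)%:E *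
   lebesgue_row n (radial_proj @^-1` A `&` eball))%E.

Let measurable_enorm :
  measurable_fun setT (@enorm R n : 'rV[R]_n -> measurableTypeR R).
Proof.
apply: (measurableT_comp (f := Num.sqrt : R -> R)).
  by apply: continuous_measurable_fun; exact: sqrt_continuous.
apply: measurable_sum => i; apply: measurable_funX; exact: measurable_coord.
Qed.

Lemma measurable_eball : measurable (@eball R n).
Proof.
rewrite (_ : eball = enorm @^-1` `]-oo, 1[); last first.
  by apply/seteqP; split=> x /=; rewrite in_itv.
by rewrite -[X in measurable X]setTI; exact: measurable_enorm.
Qed.

Lemma measurable_radial_proj : measurable_fun setT radial_proj.
Proof.
apply: measurable_fun_rowP => i.
rewrite (_ : (fun t => _) =
    fun t : 'rV[R]_n => enorm t `^ (-1) * t ord0 i); last first.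
  by apply/funext => t; rewrite mxE powR_inv1// sqrtr_ge0.
apply: measurable_funM; last exact: measurable_coord.
apply: (measurableT_comp (f := fun r : R => r `^ (-1))).
  exact: measurable_powR.
exact: measurable_enorm.
Qed.

Let fine_ball_inv_ge0 : 0 <= (fine (lebesgue_row n (@eball R n)))^-1.
Proof. by rewrite invr_ge0 fine_ge0. Qed.

Let sphere_measure_measure :
  exists mu : {measure set 'rV[R]_n -> \bar R}, sphere_measure = mu :> (_ -> _).
Proof.
have mproj := measurable_radial_proj.
pose cone := pushforward (mrestr (lebesgue_row n) measurable_eball) radial_proj
  : {measure set 'rV[R]_n -> \bar R}.
by exists (mscale (NngNum fine_ball_inv_ge0) (cone mproj)).
Qed.

Let sphere_measure0 : sphere_measure set0 = 0%E.
Proof. by have [mu ->] := sphere_measure_measure; exact: measure0. Qed.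

Let sphere_measure_ge0 A : (0 <= sphere_measure A)%E.
Proof. by have [mu ->] := sphere_measure_measure; exact: measure_ge0. Qed.

Let sphere_measure_sigma_additive : semi_sigma_additive sphere_measure.
Proof.
by have [mu ->] := sphere_measure_measure; exact: measure_semi_sigma_additive.
Qed.

HB.instance Definition _ := isMeasure.Build _ _ _ sphere_measure
  sphere_measure0 sphere_measure_ge0 sphere_measure_sigma_additive.

End sphere_measure.

Section poisson.
Context {R : realType} {n : nat}.
Implicit Types x z : 'rV[R]_n.

Definition poisson_kernel x z : R := (1 - enorm x ^+ 2) / enorm (x - z) ^+ n.

Definition poisson (psi : 'rV[R]_n -> R) x : R :=
  \int[sphere_measure]_(z in esphere) (poisson_kernel x z * psi z).

Definition poisson_vec (m : nat) (f : 'rV[R]_n -> 'rV[R]_m) x : 'rV[R]_m :=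
  \row_(j < m) poisson (fun z => f z ord0 j) x.

(* The Poisson integral of the sign of the last coordinate on the open ball,
   extended by its continuous boundary value 1 at the north pole. *)
Definition hemisphere_harmonic x : R :=
  if x == north then 1
  else poisson (fun z => \1_upper_hemisphere z - \1_lower_hemisphere z) x.

End poisson.

Section poisson_equation.
Context {R : realType} {n m : nat}.

(* Functions on the closed ball are represented by total functions, of which
   only the values on the closed ball matter. *)
Definition solves_poisson (f g : 'rV[R]_n -> 'rV[R]_m) : Prop :=
  [/\ {within ecball, continuous g},
      {within ecball, continuous f},
      Ck 2 eball f &
      forall x, eball x -> laplacian f x = g x].

End poisson_equation.

(* Main.v *)
Require Import Defs.
From HB Require Import structures.
From mathcomp Require Import all_boot all_order all_algebra.
From mathcomp Require Import all_classical all_reals all_analysis.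
From mathcomp Require Import measurable_realfun ring lra.
Import Order.TTheory GRing.Theory Num.Theory.
Import numFieldNormedType.Exports.
Local Open Scope classical_set_scope.
Local Open Scope ring_scope.

(** Write [P] for the Poisson integral of [f].  The estimate is the triangle
    inequality through [P x] in the open ball; on the sphere it says that
    [enorm (f x) <= supnorm P].

    The distance from [f x] to [P x] ([sub_poisson_vec_le]).  The function
    [f - P] has Laplacian [g] and vanishes on the sphere, so for a unit vector
    [v] the function [v.(f - P) + supnorm g / (2 n) (|x|^2 - 1)] is subharmonic
    and zero on the sphere, hence nonpositive by [maximum_principle].

    The distance from [P x] to [c P 0] ([poisson_sub_equator_le]).  With [K] the
    Poisson kernel, [P x - c P 0] is the integral of [f z] against [K x z - c].
    The constant [c] of the theorem is the value of the kernel at the points [z]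
    orthogonal to [x], and the kernel decreases with the distance to [x], so the
    sign of [K x z - c] distinguishes the hemisphere centred at [x / |x|] from
    its complement.  The integral of [|K x z - c|] is then the Poisson integral
    of that sign, which a reflection turns into [hemisphere_harmonic]; and [f]
    is bounded on the sphere by [supnorm P] because [P] takes the boundary
    values of [f].

    Two things are built for this.  First, the rotation invariance of the
    surface measure: it is inherited from Lebesgue measure, where it is the
    uniqueness of Haar measure tested on the ball ([lebesgue_row_reflect]).
    Only reflections occur, since they already act transitively on spheres.
    Second, the Dirichlet problem in the ball: the kernel is harmonic
    ([sum_kernel_d2]), hence so is every Poisson integral
    ([poisson_has_laplacian]); the mass of the kernel is 1 because it is
    harmonic and rotation invariant ([poisson_one]); and the kernel concentrates
    near its pole ([poisson_boundary]).  Laplacians are read off second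
    difference quotients ([has_laplacian]), which is all that the maximum
    principle needs.

    For the paraboloid [M (1 - |x|^2)] the boundary values, and with them [P],
    are zero: both sides are [M (1 - |x|^2)]. *)

Set Implicit Arguments.
Unset Strict Implicit.
Unset Printing Implicit Defensive.

(** * Euclidean geometry *)

Section dot_product.
Context {R : realType} {n : nat}.
Implicit Types x y z w : 'rV[R]_n.

Definition dot x y : R := \sum_(i < n) x ord0 i * y ord0 i.

Lemma dotC x y : dot x y = dot y x.
Proof. by apply: eq_bigr => i _; rewrite mulrC. Qed.

Lemma dotDl x y z : dot (x + y) z = dot x z + dot y z.
Proof.
by rewrite /dot -big_split/=; apply: eq_bigr => i _; rewrite mxE mulrDl.
Qed.

Lemma dotZl a x y : dot (a *: x) y = a * dot x y.
Proof.
by rewrite /dot mulr_sumr; apply: eq_bigr => i _; rewrite mxE mulrA.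
Qed.

Lemma dotNl x y : dot (- x) y = - dot x y.
Proof. by rewrite -scaleN1r dotZl mulN1r. Qed.

Lemma dotBl x y z : dot (x - y) z = dot x z - dot y z.
Proof. by rewrite dotDl dotNl. Qed.

Lemma dotDr x y z : dot x (y + z) = dot x y + dot x z.
Proof. by rewrite dotC dotDl !(dotC _ x). Qed.

Lemma dotZr a x y : dot x (a *: y) = a * dot x y.
Proof. by rewrite dotC dotZl (dotC _ x). Qed.

Lemma dotNr x y : dot x (- y) = - dot x y.
Proof. by rewrite dotC dotNl (dotC _ x). Qed.

Lemma dotBr x y z : dot x (y - z) = dot x y - dot x z.
Proof. by rewrite dotDr dotNr. Qed.

Lemma dot0l y : dot 0 y = 0.
Proof. by rewrite -(scale0r (0 : 'rV[R]_n)) dotZl mul0r. Qed.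

Lemma dot_sumr (I : finType) (F : I -> 'rV[R]_n) x :
  dot x (\sum_i F i) = \sum_i dot x (F i).
Proof.
elim/big_ind2 : _ => [|a b c d <- <-|//]; first by rewrite dotC dot0l.
by rewrite dotDr.
Qed.

Lemma dotE_enorm x : dot x x = enorm x ^+ 2.
Proof.
rewrite sqr_sqrtr; last by apply: sumr_ge0 => i _; exact: sqr_ge0.
by apply: eq_bigr => i _; rewrite expr2.
Qed.

Lemma dot_delta x i : dot x (delta_mx ord0 i) = x ord0 i.
Proof.
rewrite /dot (bigD1 i)//= big1 ?addr0 ?mxE ?eqxx ?mulr1// => j ji.
by rewrite mxE (negbTE ji) andbF mulr0.
Qed.

Lemma enorm_ge0 x : 0 <= enorm x.
Proof. exact: sqrtr_ge0. Qed.

Lemma enorm0 : enorm (0 : 'rV[R]_n) = 0.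
Proof. by apply/eqP; rewrite -sqrf_eq0 -dotE_enorm dot0l. Qed.

Lemma coord_le_enorm x i : `|x ord0 i| <= enorm x.
Proof.
rewrite -(@ler_pXn2r _ 2) ?nnegrE ?enorm_ge0// -dotE_enorm /dot (bigD1 i)//=.
rewrite real_normK ?num_real// expr2 lerDl; apply: sumr_ge0 => j _.
by rewrite -expr2 sqr_ge0.
Qed.

Lemma enorm0_eq0 x : enorm x = 0 -> x = 0.
Proof.
move=> x0; apply/rowP => i; rewrite mxE; apply/eqP.
by rewrite -normr_le0 -x0 coord_le_enorm.
Qed.

Lemma enorm_gt0 x : (0 < enorm x) = (x != 0).
Proof.
rewrite lt_def enorm_ge0 andbT; congr negb.
by apply/eqP/eqP => [/enorm0_eq0//|->]; rewrite enorm0.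
Qed.

Lemma enormZ a x : enorm (a *: x) = `|a| * enorm x.
Proof.
apply/eqP; rewrite -(@eqrXn2 _ 2) ?enorm_ge0 ?mulr_ge0 ?enorm_ge0//.
by rewrite exprMn -!dotE_enorm dotZl dotZr real_normK ?num_real// mulrA.
Qed.

Lemma enormN x : enorm (- x) = enorm x.
Proof. by rewrite -scaleN1r enormZ normrN1 mul1r. Qed.

Lemma enormBC x y : enorm (x - y) = enorm (y - x).
Proof. by rewrite -enormN opprB. Qed.

(** Cauchy-Schwarz, by expanding the square of [enorm y *: x - enorm x *: y]. *)
Lemma dot_le_enorm x y : dot x y <= enorm x * enorm y.
Proof.
have [->|x0] := eqVneq x 0; first by rewrite dot0l mulr_ge0 ?enorm_ge0.
have [->|y0] := eqVneq y 0; first by rewrite dotC dot0l mulr_ge0 ?enorm_ge0.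
have xy_gt0 : 0 < enorm x * enorm y by rewrite mulr_gt0 ?enorm_gt0.
have := sqr_ge0 (enorm (enorm y *: x - enorm x *: y)).
rewrite -dotE_enorm !(dotBl, dotBr, dotZl, dotZr) !dotE_enorm (dotC y x).
move: xy_gt0; set a := enorm x; set b := enorm y; set d := dot x y => ab h.
rewrite -(ler_pM2l ab); nra.
Qed.

Lemma normr_dot_le x y : `|dot x y| <= enorm x * enorm y.
Proof. by rewrite ler_norml dot_le_enorm lerNl -dotNl -(enormN x) dot_le_enorm.
  Qed.

Lemma ler_enormD x y : enorm (x + y) <= enorm x + enorm y.
Proof.
rewrite -(@ler_pXn2r _ 2) ?nnegrE ?addr_ge0 ?enorm_ge0//.
rewrite -dotE_enorm !(dotDl, dotDr) !dotE_enorm (dotC y x).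
have := dot_le_enorm x y; lra.
Qed.

Lemma ler_enorm_dist x y : `|enorm x - enorm y| <= enorm (x - y).
Proof.
rewrite ler_norml; apply/andP; split.
  by have := ler_enormD (y - x) x; rewrite subrK enormBC; lra.
by have := ler_enormD (x - y) y; rewrite subrK; lra.
Qed.

(** Duality: vector-valued estimates reduce to scalar ones, to which the maximum
    principle applies. *)
Lemma enorm_le_dot x (M : R) :
  (forall v, enorm v <= 1 -> dot v x <= M) -> enorm x <= M.
Proof.
move=> h; have [->|x0] := eqVneq x 0.
  by have := h 0; rewrite dot0l enorm0; exact.
have xgt0 : 0 < enorm x by rewrite enorm_gt0.
have := h ((enorm x)^-1 *: x).
rewrite enormZ dotZl dotE_enorm ger0_norm ?invr_ge0 ?enorm_ge0//.
by rewrite mulVf ?gt_eqF// => /(_ (lexx _)); rewrite expr2 mulKf ?gt_eqF.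
Qed.

Lemma enorm_delta i : enorm (delta_mx ord0 i : 'rV[R]_n) = 1.
Proof.
apply/eqP; rewrite -(@eqrXn2 _ 2) ?enorm_ge0// -dotE_enorm dot_delta.
by rewrite mxE !eqxx expr1n.
Qed.

Lemma enorm_sqr_shift x i (t : R) :
  enorm (x + t *: delta_mx ord0 i) ^+ 2
  = enorm x ^+ 2 + 2 * (t * x ord0 i) + t ^+ 2.
Proof.
rewrite -dotE_enorm !(dotDl, dotDr) !(dotZl, dotZr) (dotC _ x) !dot_delta.
by rewrite !dotE_enorm !mxE !eqxx /=; ring.
Qed.

Lemma ecballE x : ecball x <-> eball x \/ esphere x.
Proof.
rewrite /ecball /eball /esphere/=; split; last by case=> [/ltW|->].
by rewrite le_eqVlt => /orP[/eqP|]; [right|left].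
Qed.

End dot_product.

Section euclidean_topology.
Context {R : realType} {n : nat}.
Implicit Types x y : 'rV[R]_n.

Lemma enorm_continuous : continuous (@enorm R n).
Proof.
move=> x; apply: (@continuous_comp _ _ _ (fun y => \sum_(i < n) y ord0 i ^+ 2)
  Num.sqrt); last exact: sqrt_continuous.
apply: (@continuous_big R 'I_n +%R 0 xpredT (@add_continuous _) _ _
  (fun i y => y ord0 i ^+ 2)) => i _ {}x.
by apply: (@continuous_comp _ _ _ (fun y : 'rV[R]_n => y ord0 i) (fun u =>
  u ^+ 2)); [exact: coord_continuous|exact: exprn_continuous].
Qed.

Lemma norm_le_enorm x : `|x| <= enorm x.
Proof.
rewrite [leLHS]/Num.norm/= mx_normrE; apply: bigmax_le; first exact: enorm_ge0.
by move=> [i j] _; rewrite (ord1 i); exact: coord_le_enorm.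
Qed.

(** The topology comes from the sup norm, which [enorm] dominates; conversely
    [enorm] is continuous. *)
Lemma nbhs_enormP x (U : set 'rV[R]_n) :
  nbhs x U <-> exists2 e, 0 < e & forall y, enorm (y - x) < e -> U y.
Proof.
split=> [/nbhs_ballP[e /= e0 xU]|[e e0 xU]].
  exists e => // y yx; apply: xU; rewrite -ball_normE/= distrC.
  exact: le_lt_trans (norm_le_enorm _) yx.
have cx : {for x, continuous (fun y => enorm (y - x))}.
  apply: (@continuous_comp _ _ _ (fun y => y - x) enorm);
    last exact: enorm_continuous.
  exact: (@continuousB _ _ _ id (cst x) x (@cvg_id _ _) (@cst_continuous _ _ _
    _)).
move/cvgrPdist_lt : cx => /(_ _ e0); apply: filterS => y /=.
by rewrite subrr enorm0 add0r normrN ger0_norm ?enorm_ge0//; exact: xU.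
Qed.

Lemma continuous_enormP (f : 'rV[R]_n -> R) x :
  {for x, continuous f} <-> forall e, 0 < e -> exists2 d, 0 < d &
    forall y, enorm (y - x) < d -> `|f y - f x| < e.
Proof.
split=> [/cvgrPdist_lt cf e /cf/nbhs_enormP[d d0 h]|h].
  by exists d => // y /h; rewrite distrC.
apply/(@cvgrPdist_lt _ _ _ (nbhs x) (@nbhs_filter _ x)) => e /h[d d0 {}h];
  apply/nbhs_enormP; exists d => // y /h.
by rewrite distrC.
Qed.

Lemma within_continuous_enormP (D : set 'rV[R]_n) (f : 'rV[R]_n -> R) :
  {within D, continuous f} <->
  forall x, D x -> forall e, 0 < e -> exists2 d, 0 < d &
    forall y, D y -> enorm (y - x) < d -> `|f y - f x| < e.
Proof.
rewrite subspace_continuousP; split=> [cf x Dx e e0|cf x Dx].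
  have /cvgrPdist_lt/(_ _ e0)/nbhs_enormP[d d0 h] := cf x Dx.
  by exists d => // y Dy /h; rewrite distrC; exact.
apply/cvgrPdist_lt => e /(cf x Dx)[d d0 h].
by apply/nbhs_enormP; exists d => // y yx Dy; rewrite distrC h.
Qed.

Lemma open_eball : open (@eball R n).
Proof.
rewrite (_ : eball = enorm @^-1` [set t | t < 1])//.
by apply: open_comp => [x _|]; [exact: enorm_continuous|exact: open_lt].
Qed.

Lemma compact_ball (r : R) : compact [set x : 'rV[R]_n | enorm x <= r].
Proof.
apply: bounded_closed_compact.
  exists r; split; first exact: num_real.
  by move=> M rM x /= xr; rewrite (le_trans (norm_le_enorm _))//
    (le_trans xr)// ltW.
rewrite (_ : [set x | _] = enorm @^-1` [set t | t <= r])//.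
by apply: preimage_closed => [x _|]; [exact: enorm_continuous|exact: closed_le].
Qed.

End euclidean_topology.

(** * Reflections *)

Section reflection.
Context {R : realType} {n : nat}.
Implicit Types x y w : 'rV[R]_n.

(** For [w = 0] the coefficient is a division by zero, hence zero, and the
    reflection is the identity; this is what makes [reflect_swap] true without
    exception. *)
Definition reflect_along w x : 'rV[R]_n := x - (2 * dot x w / dot w w) *: w.

Lemma dot_reflect w x y : dot (reflect_along w x) (reflect_along w y) = dot x y.
Proof.
have [->|w0] := eqVneq w 0; first by rewrite /reflect_along !scaler0 !subr0.
have ww : dot w w != 0 by rewrite dotE_enorm expf_neq0// gt_eqF// enorm_gt0.
rewrite /reflect_along !(dotBl, dotBr, dotZl, dotZr) (dotC w y).
by field.
Qed.

Lemma enorm_reflect w x : enorm (reflect_along w x) = enorm x.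
Proof.
by apply/eqP; rewrite -(@eqrXn2 _ 2) ?enorm_ge0// -!dotE_enorm dot_reflect.
Qed.

Lemma reflectD w x y :
  reflect_along w (x + y) = reflect_along w x + reflect_along w y.
Proof.
rewrite /reflect_along dotDl mulrDr mulrDl scalerDl opprD !addrA.
by congr (_ + _); rewrite addrAC.
Qed.

Lemma reflectZ w a x : reflect_along w (a *: x) = a *: reflect_along w x.
Proof.
by rewrite /reflect_along dotZl scalerBr scalerA; congr (_ - _ *: _); ring.
Qed.

Lemma reflectB w x y :
  reflect_along w (x - y) = reflect_along w x - reflect_along w y.
Proof. by rewrite -scaleN1r reflectD reflectZ scaleN1r. Qed.

Lemma reflectK w : involutive (reflect_along w).
Proof.
move=> x; have [->|w0] := eqVneq w 0; first by rewrite /reflect_along !scaler0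
  !subr0.
have ww : dot w w != 0 by rewrite dotE_enorm expf_neq0// gt_eqF// enorm_gt0.
rewrite /reflect_along -addrA -opprD -scalerDl !(dotBl, dotZl).
rewrite [X in X *: w](_ : _ = 0) ?scale0r ?subr0//.
by field.
Qed.

(** With [w = x - y] and equal norms, [w.w = 2 x.w], so the reflection removes
    exactly [w] from [x]. *)
Lemma reflect_swap x y : enorm x = enorm y -> reflect_along (x - y) x = y.
Proof.
move=> xy; have [->|w0] := eqVneq x y; first by rewrite subrr /reflect_along
  !scaler0 !subr0.
have ww : dot (x - y) (x - y) != 0.
  by rewrite dotE_enorm expf_neq0// gt_eqF// enorm_gt0 subr_eq0.
have e : dot (x - y) (x - y) = 2 * dot x (x - y).
  by rewrite !(dotBl, dotBr) !dotE_enorm (dotC y x) xy; ring.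
by rewrite /reflect_along -e divff// scale1r subKr.
Qed.

End reflection.

(** * Lebesgue measure on the space of rows *)

Section measurable_topology.
Context {R : realType} {n : nat}.

(** An open set is the union of the rational cubes inside it, and these are
    countably many. *)
Lemma measurable_open_row (U : set 'rV[R]_n) : open U -> measurable U.
Proof.
move=> oU.
pose q (p : 'rV[rat]_n * nat) : 'rV[R]_n := map_mx ratr p.1.
pose F (p : 'rV[rat]_n * nat) : set 'rV[R]_n :=
  if `[< ball (q p) p.2.+1%:R^-1 `<=` U >] then ball (q p) p.2.+1%:R^-1 else
    set0.
have -> : U = \bigcup_p F p.
  apply/seteqP; split=> [x Ux|x [p _]]; last first.
    by rewrite /F; case: asboolP => // h; exact: h.
  have /nbhs_ballP[e /= e0 xeU] := oU _ Ux.
  have [k ke] : exists k : nat, k.+1%:R^-1 < e / 2.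
    exists (Num.truncn (e / 2)^-1); rewrite invf_plt ?posrE ?divr_gt0//.
    exact: truncnS_gt.
  have h i : exists r : rat, `|x ord0 i - ratr r| < k.+1%:R^-1.
    have /rat_in_itvoo[r] : x ord0 i - k.+1%:R^-1 < x ord0 i + k.+1%:R^-1.
      by rewrite ltrD2l gt0_cp// invr_gt0.
    by rewrite in_itv/= => rx; exists r; rewrite ltr_distlC.
  have [r rP] := choice h.
  have xr : ball (q (\row_i r i, k)) k.+1%:R^-1 x.
    rewrite /ball/= /mx_ball; split=> [|i j]; first by rewrite invr_gt0.
    by rewrite (ord1 i) /ball/= !mxE distrC.
  exists (\row_i r i, k) => //; rewrite /F asboolT// => y /= qy; apply: xeU.
  apply: (@le_ball _ _ _ (k.+1%:R^-1 + k.+1%:R^-1)).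
    by rewrite [e]splitr lerD// ltW.
  exact: ball_triangle (ball_sym xr) qy.
apply: countable_bigcupT_measurable; first exact: countableP.
move=> p; rewrite /F; case: ifP => // _.
rewrite (_ : ball _ _ = \bigcap_(i in [set: 'I_n])
    ((fun x : 'rV[R]_n => x ord0 i) @^-1` ball (q p ord0 i) p.2.+1%:R^-1)).
  apply: fin_bigcap_measurable => // i _.
  rewrite -[X in measurable X]setTI; apply: measurable_coord => //.
  exact: measurable_ball.
apply/seteqP; split=> [x [_ h] i _|x h]; first exact: h.
by split=> [|i j]; [rewrite invr_gt0|rewrite (ord1 i); exact: h].
Qed.

Lemma measurable_fun_within (D : set 'rV[R]_n) (f : 'rV[R]_n -> R) :
  measurable D -> {within D, continuous f} ->
  measurable_fun D (f : _ -> measurableTypeR R).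
Proof.
move=> mD /continuousP cf; apply: (measurability _ (RGenOpens.measurableE R)).
move=> _ [_ [a [b ->] <-]].
have oab : open (`]a, b[%classic : set R) by exact: interval_open.
have := cf _ oab; rewrite open_subspaceP => -[V oV VD].
rewrite setIC -VD; apply: measurableI => //; exact: measurable_open_row.
Qed.

Lemma measurable_fun_continuous (f : 'rV[R]_n -> R) : continuous f ->
  measurable_fun setT (f : _ -> measurableTypeR R).
Proof.
move=> cf; apply: measurable_fun_within => //.
by apply/continuous_subspaceT => x; exact: cf.
Qed.

Lemma measurable_enorm :
  measurable_fun setT (@enorm R n : _ -> measurableTypeR R).
Proof. by apply: measurable_fun_continuous; exact: enorm_continuous. Qed.

Lemma measurable_esphere : measurable (@esphere R n).
Proof.
rewrite (_ : esphere = enorm @^-1` [set 1])// -[X in measurable X]setTI.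
exact: measurable_enorm.
Qed.

Lemma measurable_reflect (w : 'rV[R]_n) : measurable_fun setT (reflect_along w).
Proof.
apply: measurable_fun_rowP => i; rewrite /reflect_along /dot.
under eq_fun do rewrite mxE [X in _ + X]mxE [X in _ - X]mxE.
apply: measurable_funB; first exact: measurable_coord.
apply: measurable_funM => //; apply: measurable_funM => //.
apply: measurable_funM => //; apply: measurable_sum => j.
by apply: measurable_funM => //; exact: measurable_coord.
Qed.

End measurable_topology.

(** * Invariance of Lebesgue measure *)

Section translation.
Context {R : realType}.
Local Open Scope ereal_scope.

Let translate (v : R) (x : measurableTypeR R) : measurableTypeR R := (x + v)%R.

Let measurable_translate v : measurable_fun setT (translate v).
Proof. exact: measurable_funD. Qed.

Let lebesgue_measure_translate (v : R) (A : set (measurableTypeR R)) :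
  measurable A ->
  pushforward lebesgue_measure (translate v) A = lebesgue_measure A.
Proof.
have mv := measurable_translate v.
move=> mA; apply/esym.
apply: (@lebesgue_measure_unique R (pushforward lebesgue_measure (translate v)))
  => //= _ [[a b] _ <-].
rewrite /pushforward (_ : _ @^-1` _ = `](a - v)%R, (b - v)%R]%classic).
  rewrite !lebesgue_measure_itv/= !lte_fin ltrD2r.
  by case: ifP => // _; rewrite !EFinB; congr (_%:E); ring.
by apply/seteqP; split=> x /=; rewrite !in_itv/= ltrBlDr lerBrDr.
Qed.

Lemma ge0_integral_translate (v : R) (h : measurableTypeR R -> \bar R) :
  measurable_fun setT h -> (forall x, 0 <= h x) ->
  \int[lebesgue_measure]_x h (x + v)%R = \int[lebesgue_measure]_x h x.
Proof.
move=> mh h0; have mv := measurable_translate v.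
transitivity (\int[pushforward lebesgue_measure (translate v)]_x h x).
  by rewrite ge0_integral_pushforward.
apply: eq_measure_integral => A mA _; exact: lebesgue_measure_translate.
Qed.

Lemma ge0_integral_row_cons n (h : 'rV[R]_n.+1 -> \bar R) :
  measurable_fun setT h -> (forall x, 0 <= h x) ->
  \int[lebesgue_row n.+1]_x h x =
  \int[lebesgue_measure]_t \int[lebesgue_row n]_v h (row_cons (t, v)).
Proof.
move=> mh h0; have mc := @measurable_row_cons R n.
transitivity (\int[pushforward (lebesgue_measure \x lebesgue_row n)
  (@row_cons R n)]_x h x).
  by apply: eq_measure_integral.
rewrite ge0_integral_pushforward//.
rewrite preimage_setT.
rewrite (fubini_tonelli1 (h \o @row_cons R n))//; first exact: measurableT_comp.
by move=> x; exact: h0.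
Qed.

Lemma measurable_rowD n (v : 'rV[R]_n) :
  measurable_fun setT (fun x : 'rV[R]_n => (x + v)%R).
Proof.
apply: measurable_fun_rowP => i; under eq_fun do rewrite mxE.
by apply: measurable_funD => //; exact: measurable_coord.
Qed.

(** Induction on the dimension: the measure is an iterated product, and each
    factor is invariant. *)
Lemma ge0_integral_row_translate n (v : 'rV[R]_n) (h : 'rV[R]_n -> \bar R) :
  measurable_fun setT h -> (forall x, 0 <= h x) ->
  \int[lebesgue_row n]_x h (x + v)%R = \int[lebesgue_row n]_x h x.
Proof.
elim: n => [|n IH] in v h *; move=> mh h0.
  by apply: eq_integral => x _; congr h; apply/rowP => -[].
have mhv : measurable_fun setT (fun x : 'rV[R]_n.+1 => h (x + v)%R).
  by apply: (measurableT_comp mh); exact: measurable_rowD.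
rewrite (ge0_integral_row_cons mh h0).
rewrite (ge0_integral_row_cons mhv (fun x => h0 (x + v)%R)).
have mc := @measurable_row_cons R n.
pose v' : 'rV[R]_n := \row_i v ord0 (lift ord0 i).
transitivity (\int[lebesgue_measure]_t \int[lebesgue_row n]_u
    h (row_cons ((t + v ord0 ord0)%R, (u + v')%R))).
  apply: eq_integral => t _; apply: eq_integral => u _; congr h.
  apply/rowP => i; rewrite !mxE.
  by case: unliftP => [j ->|->] //=; rewrite !mxE.
transitivity (\int[lebesgue_measure]_t \int[lebesgue_row n]_u
    h (row_cons ((t + v ord0 ord0)%R, u))).
  apply: eq_integral => t _.
  apply: (IH v' (fun u => h (row_cons ((t + v ord0 ord0)%R, u)))) => //.
  apply: (measurableT_comp mh); apply: (measurableT_comp mc).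
  exact: measurable_pair1.
apply: (ge0_integral_translate (v ord0 ord0) (h := fun t =>
  \int[lebesgue_row n]_u h (row_cons (t, u)))).
  apply: (@measurable_fun_fubini_tonelli_F _ _ _ _ _ (lebesgue_row n)
    (h \o @row_cons R n)) => //.
    exact: measurableT_comp.
  by move=> x; exact: h0.
by move=> t; exact: integral_ge0.
Qed.

End translation.

Section linear_involution.
Context {R : realType} {n : nat}.
Local Notation mu := (@lebesgue_row R n).
Variable T : 'rV[R]_n -> 'rV[R]_n.
Hypotheses (mT : measurable_fun setT T) (TD : {morph T : x y / (x + y)%R})
  (TK : involutive T).
Local Open Scope ereal_scope.

Let TB x y : T (x - y)%R = (T x - T y)%R.
Proof. by apply/eqP; rewrite eq_sym subr_eq -TD subrK. Qed.

Let int_preimage (A : set 'rV[R]_n) (S : 'rV[R]_n -> 'rV[R]_n) :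
  measurable A -> measurable_fun setT S ->
  \int[mu]_x (\1_A (S x))%:E = mu (S @^-1` A).
Proof.
move=> mA mS; rewrite -[in RHS](setIT (S @^-1` A)) -integral_indic//.
by rewrite -[X in measurable X]setTI; exact: mS.
Qed.

Let measurable_indic_comp (A : set 'rV[R]_n) d (S : measurableType d)
    (f : S -> 'rV[R]_n) :
  measurable A -> measurable_fun setT f ->
  measurable_fun setT (fun x => (\1_A (f x))%:E : \bar R).
Proof.
move=> mA mf; apply/measurable_EFinP.
by apply: (measurableT_comp (f := \1_A : _ -> R)) => //;
  exact: measurable_indic.
Qed.

Let measurable_indic_comp2 (A B : set 'rV[R]_n) d (S : measurableType d)
    (f g : S -> 'rV[R]_n) :
  measurable A -> measurable B -> measurable_fun setT f ->
  measurable_fun setT g ->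
  measurable_fun setT (fun x => (\1_A (f x))%:E * (\1_B (g x))%:E : \bar R).
Proof.
by move=> mA mB mf mg; apply: emeasurable_funM; exact: measurable_indic_comp.
Qed.

(** The computation behind the uniqueness of Haar measure.  Start from the
    double integral of the indicators of [T x] in [A] and [y] in [B], and
    translate [y] by [T x], then [x] by [- T y], then [y] by [- T x]; each
    translation preserves the integral. *)
Let haar_exchange (A B : set 'rV[R]_n) : measurable A -> measurable B ->
  mu (T @^-1` A) * mu B = mu (T @^-1` B) * mu (-%R @^-1` A).
Proof.
move=> mA mB.
have mN : measurable_fun setT (-%R : 'rV[R]_n -> 'rV[R]_n).
  apply: measurable_fun_rowP => i; under eq_fun do rewrite mxE.
  by apply: measurableT_comp => //; exact: measurable_coord.
have ind0 (C : set 'rV[R]_n) x : 0 <= (\1_C x)%:E :> \bar R by rewrite lee_fin.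
have mD : measurable_fun setT (fun p : 'rV[R]_n * 'rV[R]_n => (p.1 + p.2)%R).
  apply: measurable_fun_rowP => i; under eq_fun do rewrite mxE.
  by apply: measurable_funD;
    apply: (measurableT_comp (measurable_coord i));
      [exact: measurable_fst|exact: measurable_snd].
have mB' : measurable_fun setT (fun p : 'rV[R]_n * 'rV[R]_n => (p.1 - p.2)%R).
  apply: measurable_fun_rowP => i; under eq_fun do rewrite !mxE.
  by apply: measurable_funB;
    apply: (measurableT_comp (measurable_coord i));
      [exact: measurable_fst|exact: measurable_snd].
have mT1 : measurable_fun setT (fun p : 'rV[R]_n * 'rV[R]_n => T p.1).
  exact: measurableT_comp.
have mDT : measurable_fun setT (fun p : 'rV[R]_n * 'rV[R]_n => (p.2 + T p.1)%R).
  exact: (measurableT_comp mD (measurable_fun_pair measurable_snd mT1)).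
have mBT : measurable_fun setT (fun p : 'rV[R]_n * 'rV[R]_n => (T p.1 - p.2)%R).
  exact: (measurableT_comp mB' (measurable_fun_pair mT1 measurable_snd)).
transitivity (\int[mu]_x \int[mu]_y ((\1_A (T x))%:E * (\1_B y)%:E)).
  under eq_integral do (rewrite ge0_integralZl//;
    last exact: measurable_indic_comp).
  rewrite ge0_integralZr ?integral_ge0//; last exact: measurable_indic_comp.
  by rewrite int_preimage// integral_indic// setIT.
transitivity (\int[mu]_x \int[mu]_y ((\1_A (T x))%:E * (\1_B (y + T x))%:E)).
  apply: eq_integral => x _; apply/esym.
  apply: (ge0_integral_row_translate (T x) (h := fun y => (\1_A (T x))%:E
    * (\1_B y)%:E)).
    by apply: measurable_funeM; exact: measurable_indic_comp.
  by move=> y; rewrite mule_ge0.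
rewrite (fubini_tonelli (fun p : 'rV[R]_n * 'rV[R]_n => (\1_A (T p.1))%:E
  * (\1_B (p.2 + T p.1))%:E))//=; last exact: measurable_indic_comp2.
transitivity (\int[mu]_y \int[mu]_x ((\1_A (T x - y)%R)%:E * (\1_B (T x))%:E)).
  apply: eq_integral => y _.
  rewrite -(ge0_integral_row_translate (- T y) (h := fun x => (\1_A (T x))%:E
    * (\1_B (y + T x))%:E)).
  - by apply: eq_integral => x _; rewrite TB TK addrCA subrr addr0.
  - apply: measurable_indic_comp2 => //.
    by under eq_fun do rewrite addrC;
      exact: (measurableT_comp (measurable_rowD y) mT).
  - by move=> x; rewrite mule_ge0.
rewrite -(fubini_tonelli (fun p : 'rV[R]_n * 'rV[R]_n =>
  (\1_A (T p.1 - p.2)%R)%:E * (\1_B (T p.1))%:E))//=;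
  last exact: measurable_indic_comp2.
transitivity (\int[mu]_x ((\1_B (T x))%:E * \int[mu]_y (\1_A (- y)%R)%:E)).
  apply: eq_integral => x _.
  rewrite -(ge0_integral_row_translate (- T x) (h := fun y =>
    (\1_A (- y)%R)%:E))//; last exact: measurable_indic_comp.
  rewrite -ge0_integralZl//; last first.
    by apply: measurable_indic_comp => //; apply: (measurableT_comp mN);
      exact: measurable_rowD.
  by apply: eq_integral => y _; rewrite opprB muleC.
by rewrite ge0_integralZr ?integral_ge0// ?int_preimage//;
  exact: measurable_indic_comp.
Qed.

(** Cancel the measure of a set [B] that [T] preserves.  The right-hand side
    does not depend on [T], so any two such involutions agree, in particular [T] and
    the identity. *)
Lemma lebesgue_row_involution (A B : set 'rV[R]_n) :
  measurable A -> measurable B -> T @^-1` B = B -> mu B \is a fin_num ->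
  mu B != 0 -> mu (T @^-1` A) = mu (-%R @^-1` A).
Proof.
move=> mA mB TBB fB B0; have := haar_exchange mA mB.
rewrite TBB [RHS]muleC -(fineK fB) => /(congr1 (mule^~ (fine (mu B))^-1%:E)).
by rewrite -!muleA -EFinM divff ?mule1// fine_eq0.
Qed.

End linear_involution.

Section ball_volume.
Context {R : realType}.
Implicit Types n : nat.

(** Cubes have a computable volume; they bound that of the ball on both
    sides. *)
Definition cube n (r : R) : set 'rV[R]_n :=
  [set x | forall i, `|x ord0 i| <= r].

Lemma cube0 n : @cube n 0 = [set 0].
Proof.
apply/seteqP; split=> [x h|x -> i]; last by rewrite mxE normr0.
by apply/rowP => i; apply/eqP; rewrite mxE -normr_le0 h.
Qed.

Lemma measurable_cube n (r : R) : measurable (@cube n r).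
Proof.
rewrite (_ : cube _ = \bigcap_(i in [set: 'I_n])
    ((fun x : 'rV[R]_n => x ord0 i) @^-1` `[- r, r])).
  apply: fin_bigcap_measurable => // i _.
  rewrite -[X in measurable X]setTI; apply: measurable_coord => //.
by apply/seteqP; split=> x /= h i; have := h i;
  rewrite /= in_itv/= ler_norml//; apply.
Qed.

Lemma lebesgue_row_cube n (r : R) : 0 <= r ->
  lebesgue_row n (cube r) = ((r *+ 2) ^+ n)%:E.
Proof.
move=> r0; elim: n => [|n IH].
  by rewrite expr0 /= diracE mem_set// => -[].
rewrite /= /pushforward.
rewrite (_ : _ @^-1` _ = (`[- r, r]%classic `*` @cube n r)); last first.
  apply/seteqP; split=> -[t v] /=.
    move=> h; split=> [|i].
      by have := h ord0; rewrite mxE unlift_none in_itv/= ler_norml.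
    by have := h (lift ord0 i); rewrite mxE liftK.
  rewrite in_itv/= -ler_norml => -[tr vr] i; rewrite mxE.
  by case: unliftP => [j|] _ //=; exact: vr.
transitivity (lebesgue_measure (`[(- r)%R, r]%classic : set R) * lebesgue_row n
  (cube r))%E.
  by apply: product_measure1E => //; exact: measurable_cube.
rewrite IH lebesgue_measure_itv/= lte_fin exprS EFinM; congr (_ * _)%E.
case: ifPn => [_|]; first by rewrite -EFinB opprK mulr2n.
rewrite -leNgt => rr; have -> : r = 0 by lra.
by rewrite mul0rn.
Qed.

Lemma lebesgue_eball_fin_num n : lebesgue_row n (@eball R n) \is a fin_num.
Proof.
rewrite ge0_fin_numE//; apply: (@le_lt_trans _ _ (lebesgue_row n (@cube n 1))).
  apply: le_measure; rewrite ?inE;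
    [exact: measurable_eball|exact: measurable_cube|].
  by move=> x /ltW x1 i; exact: le_trans (coord_le_enorm _ _) x1.
by rewrite lebesgue_row_cube// ltry.
Qed.

Lemma lebesgue_eball_gt0 n : (0 < lebesgue_row n (@eball R n))%E.
Proof.
(* The cube of half-side [1/(n+1)] fits in: [n / (n+1)^2 < 1]. *)
have r0 : 0 < n.+1%:R^-1 :> R by rewrite invr_gt0.
apply: (@lt_le_trans _ _ (lebesgue_row n (@cube n n.+1%:R^-1))).
  by rewrite lebesgue_row_cube ?ltW// lte_fin exprn_gt0// pmulrn_lgt0.
apply: le_measure; rewrite ?inE;
  [exact: measurable_cube|exact: measurable_eball|].
move=> x xr; rewrite /eball/= -(@ltr_pXn2r _ 2) ?nnegrE ?enorm_ge0//
  -dotE_enorm.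
apply: (@le_lt_trans _ _ (\sum_(i < n) n.+1%:R^-1 ^+ 2)).
  apply: ler_sum => i _; rewrite -expr2 -[leLHS]real_normK ?num_real//.
  by rewrite ler_pXn2r ?nnegrE// ltW.
rewrite sumr_const card_ord expr1n -[ltLHS]mulr_natl exprVn -[ltRHS](@divff _
  (n.+1%:R ^+ 2)) ?expf_neq0//.
rewrite ltr_pM2r ?invr_gt0 ?exprn_gt0// -natrX ltr_nat.
by rewrite expnS expn1 leq_pmulr.
Qed.

Lemma lebesgue_row0 n : (0 < n)%N -> lebesgue_row n [set (0 : 'rV[R]_n)] = 0%E.
Proof.
by case: n => // n _; rewrite -cube0 lebesgue_row_cube// mul0rn exprS mul0r.
Qed.

(** The ball has positive finite measure and every reflection preserves it: it
    is the set to be cancelled, for the reflection and for the identity. *)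
Lemma lebesgue_row_reflect n (w : 'rV[R]_n) (A : set 'rV[R]_n) :
  measurable A -> lebesgue_row n (reflect_along w @^-1` A) = lebesgue_row n A.
Proof.
move=> mA; have B0 := lebesgue_eball_gt0 n; have Bf := lebesgue_eball_fin_num n.
rewrite (lebesgue_row_involution (measurable_reflect w) (reflectD w)
  (@reflectK _ _ w) mA (@measurable_eball R n))//; last 2 first.
- by apply/seteqP; split=> x; rewrite /eball/= enorm_reflect.
- by rewrite gt_eqF.
rewrite -(@lebesgue_row_involution R n id _ _ _ A eball)//;
  [exact: measurable_eball|].
by rewrite gt_eqF.
Qed.

End ball_volume.

(** * Integration over the sphere *)

Section sphere_integral.
Context {R : realType} {n : nat}.
Hypothesis n_gt0 : (0 < n)%N.
Local Notation sigma := (@sphere_measure R n).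
Implicit Types (w z : 'rV[R]_n) (f g : 'rV[R]_n -> R).

(** Only the centre of the ball does not project onto the sphere. *)
Lemma sphere_measure_esphere : sigma esphere = 1%E.
Proof.
rewrite /sphere_measure (_ : _ `&` _ = eball `\` [set 0]); last first.
  apply/seteqP; split=> x /=.
    move=> [px bx]; split=> // x0; move: px.
    by rewrite /esphere /radial_proj /= x0 scaler0 enorm0 => /esym/eqP;
      rewrite oner_eq0.
  move=> [bx /eqP x0]; split=> //; rewrite /esphere /radial_proj /= enormZ.
  by rewrite ger0_norm ?invr_ge0 ?enorm_ge0// mulVf// gt_eqF// enorm_gt0.
have m0 : measurable [set (0 : 'rV[R]_n)].
  by rewrite -cube0; exact: measurable_cube.
rewrite measureD//; [|exact: measurable_eball|by rewrite -ge0_fin_numE//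
  lebesgue_eball_fin_num].
rewrite [X in (_ - X)%E](_ : _ = 0%E); last first.
  apply/eqP; rewrite eq_le measure_ge0 andbT -(lebesgue_row0 n_gt0).
  apply: le_measure; rewrite ?inE//.
  by apply: measurableI => //; exact: measurable_eball.
rewrite sube0 -[X in (_ * X)%E]fineK ?lebesgue_eball_fin_num// -EFinM mulVf//.
by rewrite fine_eq0 ?lebesgue_eball_fin_num// gt_eqF// lebesgue_eball_gt0.
Qed.

Lemma sphere_measure_reflect w (A : set 'rV[R]_n) : measurable A ->
  sigma (reflect_along w @^-1` A) = sigma A.
Proof.
move=> mA; rewrite /sphere_measure; congr (_ * _)%E.
rewrite -[RHS](lebesgue_row_reflect w); last first.
  apply: measurableI; last exact: measurable_eball.
  by rewrite -[X in measurable X]setTI; exact: measurable_radial_proj.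
congr (lebesgue_row n _); apply/seteqP; split=> x;
  by rewrite /eball /radial_proj /= enorm_reflect reflectZ.
Qed.

Lemma integrable_sphere f (M : R) :
  measurable_fun esphere f -> (forall z, esphere z -> `|f z| <= M) ->
  sigma.-integrable esphere (EFin \o f).
Proof.
move=> mf fM; apply: measurable_bounded_integrable => //.
- exact: measurable_esphere.
- by rewrite [X in (X < _)%E]sphere_measure_esphere ltry.
- exists M; split; first exact: num_real.
  by move=> K MK z Sz; apply: le_trans (fM _ Sz) (ltW MK).
Qed.

Lemma Rintegral_sphere_cst (c : R) : \int[sigma]_(z in esphere) c = c.
Proof.
rewrite Rintegral_cst; last exact: measurable_esphere.
by rewrite [X in fine X]sphere_measure_esphere mulr1.
Qed.

Lemma Rintegral_sphere_reflect w f (M : R) :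
  measurable_fun esphere f -> (forall z, esphere z -> `|f z| <= M) ->
  \int[sigma]_(z in esphere) f (reflect_along w z) = \int[sigma]_(z in esphere)
    f z.
Proof.
move=> mf fM; have mS := @measurable_esphere R n.
have TSE z : (reflect_along w z \in esphere) = (z \in esphere).
  by apply/idP/idP; rewrite !inE /esphere/= enorm_reflect.
have TS : reflect_along w @^-1` esphere = esphere.
  by apply/seteqP; split=> x; rewrite /esphere/= enorm_reflect.
(* The change of variables is stated for functions measurable everywhere, so
   [f] is extended by zero off the sphere. *)
pose F : 'rV[R]_n -> \bar R := (EFin \o f) \_ esphere.
have mF : measurable_fun setT F.
  by apply/(measurable_restrictT _ mS); exact/measurable_EFinP.
have Ff z : z \in esphere -> F z = (f z)%:E by rewrite /F patchE => ->.
rewrite /Rintegral; congr fine.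
transitivity (\int[sigma]_(z in esphere) (F \o reflect_along w) z)%E.
  by apply: eq_integral => z Sz /=; rewrite Ff ?TSE.
transitivity (\int[pushforward sigma (reflect_along w)]_(z in esphere) F z)%E.
  rewrite integral_pushforward//; [by rewrite TS|exact: measurable_reflect|].
  rewrite TS; apply: (eq_integrable _ (EFin \o (f \o reflect_along w))) => //.
    by move=> z Sz /=; rewrite Ff ?TSE.
  apply: (integrable_sphere (M := M)).
    apply: (measurable_comp (F := esphere)) => //.
      by move=> _ [z Sz <-]; rewrite /esphere/= enorm_reflect.
    by apply: measurable_funTS; exact: measurable_reflect.
  by move=> z Sz; apply: fM; rewrite /esphere/= enorm_reflect.
transitivity (\int[sigma]_(z in esphere) F z)%E.
  apply: eq_measure_integral => [|? A mA _]; first exact: measurable_reflect.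
  exact: sphere_measure_reflect.
by apply: eq_integral => z /Ff.
Qed.

End sphere_integral.

(** * Second differences *)

Section second_difference.
Context {R : realType}.
Implicit Types (g dg ddg : R -> R) (h t c : R).

(** The second difference quotient is a difference quotient of the derivative
    at an intermediate point: Cauchy's mean value theorem for
    [g t + g (- t)] and [t ^+ 2]. *)
Lemma second_difference_mvt g dg h : 0 < h ->
  (forall t, `|t| <= h -> is_derive t 1 g (dg t)) ->
  exists2 c, 0 < c < h &
    (g h + g (- h) - 2 * g 0) / h ^+ 2 = (dg c - dg (- c)) / (2 * c).
Proof.
move=> h0 gd; set K := g h + g (- h) - 2 * g 0.
pose Phi t := h ^+ 2 * (g t + g (- t)) - K * t ^+ 2.
have Phid t : `|t| <= h ->
    is_derive t 1 Phi (h ^+ 2 * (dg t - dg (- t)) - K * (2 * t)).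
  move=> th; have g1 := gd _ th.
  have g2 : is_derive t 1 (g \o -%R) (dg (- t) * -1).
    by apply: is_derive1_comp; apply: gd; rewrite normrN.
  have g3 : is_derive t 1 (h ^+ 2 *: (g + (g \o -%R)) - K *: (id ^+ 2))
    (h ^+ 2 *: (dg t + dg (- t) * -1) - K *: ((2%:R * t ^+ 1) *: 1)).
    exact: is_deriveB.
  apply: is_derive_eq g3 _.
  by rewrite mulrN1 expr1 /GRing.scale/= mulr1.
have [|||c ch [_ Pc]] := @Rolle R Phi 0 h h0.
- by move=> t; rewrite in_itv/= => /andP[t0 th]; have [] := Phid t;
  rewrite ?gtr0_norm// ltW.
- apply: derivable_within_continuous => t; rewrite in_itv/= => /andP[t0 th].
  by have [] := Phid t; rewrite ?ger0_norm.
- by rewrite /Phi /K oppr0; ring.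
move: ch; rewrite in_itv/= => /andP[c0 ch]; exists c; first by rewrite c0.
have [_] : is_derive c 1 Phi (h ^+ 2 * (dg c - dg (- c)) - K * (2 * c)).
  by apply: Phid; rewrite gtr0_norm// ltW.
rewrite Pc => /eqP; rewrite eq_sym subr_eq0 => /eqP E.
have h_neq0 : h ^+ 2 != 0 by rewrite gt_eqF// exprn_gt0.
have c_neq0 : 2 * c != 0 by rewrite gt_eqF// mulr_gt0.
apply/eqP; rewrite eqr_div//; apply/eqP.
by rewrite [RHS]mulrC E.
Qed.

(** A second mean value theorem, now for the derivative on [[- c, c]]. *)
Lemma second_difference_mvt2 g dg ddg h : 0 < h ->
  (forall t, `|t| <= h -> is_derive t 1 g (dg t)) ->
  (forall t, `|t| <= h -> is_derive t 1 dg (ddg t)) ->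
  exists2 c, `|c| <= h &
    (g h + g (- h) - 2 * g 0) / h ^+ 2 = ddg c.
Proof.
move=> h0 gd dgd; have [c /andP[c0 ch] ->] := second_difference_mvt h0 gd.
have cc : - c < c by lra.
have dgd' t : t \in `[- c, c] -> is_derive t 1 dg (ddg t).
  rewrite in_itv/= => /andP[ct tc]; apply: dgd; rewrite ler_norml; lra.
have [|t tc ->] := MVT cc (fun t tc => dgd' t (subset_itv_oo_cc tc)).
  by apply: derivable_within_continuous => t /dgd'[].
exists t; first by move: tc; rewrite in_itv/= ler_norml => /andP[]; lra.
by field; rewrite gt_eqF.
Qed.

(** Here [dg] is differentiable at 0 only: the quotient
    [(dg c - dg (- c)) / (2 c)] is the mean of the difference quotients of [dg]
    at 0 for the increments [c] and [- c]. *)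
Lemma second_difference_cvg g dg (l d : R) : 0 < d ->
  (forall t, `|t| <= d -> is_derive t 1 g (dg t)) -> is_derive (0 : R) 1 dg l ->
  (fun k => (g (harmonic k) + g (- harmonic k) - 2 * g 0) / harmonic k ^+ 2)
    @ \oo --> l.
Proof.
move=> d0 gd [dg0 dgl].
have /cvgrPdist_le cl : (fun h : R => h^-1 * (dg (h * 1 + 0) - dg 0)) @ 0^'
  --> l.
  by rewrite -dgl; exact: dg0.
apply/cvgrPdist_le => e e0; have := cl e e0.
rewrite /prop_near1 /dnbhs /within/= => /nbhs_ballP[r /= r0 rP].
have qP c : 0 < `|c| < r -> `|l - (dg c - dg 0) / c| <= e.
  move=> /andP[c0 cr].
  have := rP c; rewrite -ball_normE/= sub0r normrN => /(_ cr).
  rewrite -normr_gt0 => /(_ c0).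
  by rewrite addr0 /GRing.scale/= mulr1 mulrC.
have /cvgrPdist_lt/(_ (Order.min d r)) := @cvg_harmonic R.
rewrite lt_min d0 r0 => /(_ isT); apply: filterS => k.
rewrite sub0r normrN gtr0_norm ?harmonic_gt0// lt_min => /andP[kd kr].
have [|c /andP[c0 ck] ->] := @second_difference_mvt g dg _ (harmonic_gt0 k).
  by move=> t tk; apply: gd; exact: le_trans tk (ltW kd).
have h1 := qP c; have h2 := qP (- c).
rewrite (_ : l - _ = (l - (dg c - dg 0) / c) / 2 + (l - (dg (- c) - dg 0) /
  (- c)) / 2); last first.
  by field; rewrite gt_eqF.
apply: le_trans (ler_normD _ _) _; rewrite !normrM (ger0_norm (_ : 0 <= 2^-1))
  ?invr_ge0//.
rewrite [e]splitr lerD// ler_pM2r ?invr_gt0//.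
  by apply: h1; rewrite gtr0_norm// c0 (lt_trans ck).
by apply: h2; rewrite normrN gtr0_norm// c0 (lt_trans ck).
Qed.

End second_difference.

Section laplacian_sequence.
Context {R : realType} {n : nat}.
Implicit Types (F G : 'rV[R]_n -> R) (x : 'rV[R]_n).

Definition row_line x (i : 'I_n) (t : R) : 'rV[R]_n := x + t *: delta_mx ord0 i.

Definition second_quotient F x (h : R) : R :=
  \sum_(i < n) (F (row_line x i h) + F (row_line x i (- h)) - 2 * F x) / h ^+ 2.

(** The Laplacian as a limit along [1/(k+1)].  In this form it passes under an
    integral sign by a single dominated convergence, and its sign at a maximum
    is immediate. *)
Definition has_laplacian F x (L : R) : Prop :=
  (fun k => second_quotient F x (harmonic k)) @ \oo --> L.

Lemma second_quotientD F G x h :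
  second_quotient (fun y => F y + G y) x h
  = second_quotient F x h + second_quotient G x h.
Proof.
by rewrite /second_quotient -big_split/=; apply: eq_bigr => i _; ring.
Qed.

Lemma second_quotientZ a F x h :
  second_quotient (fun y => a * F y) x h = a * second_quotient F x h.
Proof. by rewrite /second_quotient mulr_sumr; apply: eq_bigr => i _; ring. Qed.

Lemma has_laplacianD F G x L L' : has_laplacian F x L -> has_laplacian G x L' ->
  has_laplacian (fun y => F y + G y) x (L + L').
Proof.
rewrite /has_laplacian => FL GL.
by under eq_fun do rewrite second_quotientD; exact: cvgD.
Qed.

Lemma has_laplacianZ a F x L : has_laplacian F x L ->
  has_laplacian (fun y => a * F y) x (a * L).
Proof.
rewrite /has_laplacian => FL.
by under eq_fun do rewrite second_quotientZ; apply: cvgMl_tmp.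
Qed.

Lemma enorm_row_line_sub x i t : enorm (row_line x i t - x) = `|t|.
Proof. by rewrite /row_line addrC addKr enormZ enorm_delta mulr1. Qed.

Lemma row_lineD x i s t : row_line (row_line x i s) i t = row_line x i (s + t).
Proof. by rewrite /row_line -addrA -scalerDl. Qed.

Lemma row_line0 x i : row_line x i 0 = x.
Proof. by rewrite /row_line scale0r addr0. Qed.

Lemma near_has_laplacian F G x L (d : R) : 0 < d ->
  (forall y, enorm (y - x) < d -> F y = G y) ->
  has_laplacian F x L -> has_laplacian G x L.
Proof.
move=> d0 FG; rewrite /has_laplacian => FL; apply: cvg_trans FL.
apply: near_eq_cvg; have /cvgrPdist_lt/(_ d d0) := @cvg_harmonic R.
apply: filterS => k; rewrite sub0r normrN => kd.
apply: eq_bigr => i _; rewrite !FG//.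
- by rewrite subrr enorm0.
- by rewrite enorm_row_line_sub normrN.
- by rewrite enorm_row_line_sub.
Qed.

Lemma has_laplacian_sqr_enorm x :
  has_laplacian (fun y => enorm y ^+ 2 - 1) x (2 * n%:R).
Proof.
rewrite /has_laplacian.
rewrite (_ : (fun k => _) = cst (2 * n%:R)); first exact: cvg_cst.
apply/funext => k; rewrite /second_quotient (eq_bigr (fun=> 2)).
  by rewrite sumr_const card_ord mulr_natr.
move=> i _; rewrite /row_line !enorm_sqr_shift.
have : harmonic k != 0 :> R by rewrite gt_eqF// harmonic_gt0.
by move: (harmonic k) => h h0; field.
Qed.

End laplacian_sequence.

Section laplacian_C2.
Context {R : realType} {n m : nat}.
Implicit Types (f : 'rV[R]_n -> 'rV[R]_m) (x : 'rV[R]_n) (v : 'rV[R]_m).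

Lemma dot_continuous v : continuous (dot v).
Proof.
rewrite (_ : dot v = fun y => \sum_(i < m) v ord0 i * y ord0 i)//.
apply: (@continuous_big R 'I_m +%R 0 xpredT (@add_continuous _) _ _
  (fun i (y : 'rV[R]_m) => v ord0 i * y ord0 i)) => i _ x.
by apply: (@continuous_comp _ _ _ (fun y : 'rV[R]_m => y ord0 i)
  (fun u => v ord0 i * u)); [exact: coord_continuous|exact: mulrl_continuous].
Qed.

Lemma is_derive_dot_line v f x i t :
  derivable f (row_line x i t) (delta_mx ord0 i) ->
  is_derive t 1 (fun s => dot v (f (row_line x i s)))
    (dot v (partial i f (row_line x i t))).
Proof.
move=> fd; set l := partial i f _.
have fl : (fun h : R => h^-1 *: (f (h *: delta_mx ord0 i + row_line x i t) - f
  (row_line x i t))) @ 0^' --> l.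
  exact: fd.
have vl : (fun h : R => h^-1 * (dot v (f (row_line x i (h * 1 + t))) - dot v
  (f (row_line x i t)))) @ 0^' --> dot v l.
  have := cvg_comp _ _ fl (@dot_continuous v l).
  apply: cvg_trans; apply: near_eq_cvg; near=> h.
  rewrite /= dotZr dotBr mulr1; congr (_ * (dot v (f _) - _)).
  by rewrite /row_line addrCA -scalerDl.
apply: DeriveDef; first by apply/cvg_ex; exists (dot v l).
by apply/cvg_lim.
Unshelve. all: by end_near. Qed.

Lemma Ck2_has_laplacian v f x : Ck 2 eball f -> eball x ->
  has_laplacian (fun y => dot v (f y)) x (dot v (laplacian f x)).
Proof.
move=> [_ f2] bx; rewrite /laplacian dot_sumr.
apply: (@cvg_big R 'I_n +%R 0 xpredT (@add_continuous _) nat \oo (index_enum _)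
  (fun i k => (dot v (f (row_line x i (harmonic k)))
     + dot v (f (row_line x i (- harmonic k))) - 2 * dot v (f x)) / harmonic k
       ^+ 2)) => i _.
have [fd [_ /(_ i)[fdd _]]] := f2 i.
have bl t : `|t| <= (1 - enorm x) / 2 -> eball (row_line x i t).
  move=> tx; rewrite /eball/= (le_lt_trans (ler_enormD _ _))//.
  by rewrite enormZ enorm_delta mulr1; move: bx; rewrite /eball/=; lra.
have := @second_difference_cvg R (fun t => dot v (f (row_line x i t)))
  (fun t => dot v (partial i f (row_line x i t)))
    (dot v (partial i (partial i f) x)) ((1 - enorm x) / 2).
rewrite row_line0; apply.
- by rewrite divr_gt0// subr_gt0.
- by move=> t /bl/fd; exact: is_derive_dot_line.
- have := @is_derive_dot_line v (partial i f) x i 0; rewrite row_line0; apply.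
  exact: fdd.
Qed.

End laplacian_C2.

(** * The Poisson kernel *)

Section kernel_derivatives.
Context {R : realType} {n : nat}.
Implicit Types (F G : 'rV[R]_n -> R) (x u z : 'rV[R]_n) (i : 'I_n) (k : nat).

Definition line_derive F x i (l : R) : Prop :=
  is_derive (0 : R) 1 (fun t => F (row_line x i t)) l.

Definition inv_enorm k u : R := (enorm u ^+ k)^-1.

Lemma line_derive_eq F x i l l' : line_derive F x i l -> l = l' ->
  line_derive F x i l'.
Proof. by move=> ? <-. Qed.

Lemma line_deriveM F G x i l l' : line_derive F x i l -> line_derive G x i l' ->
  line_derive (fun y => F y * G y) x i (F x * l' + G x * l).
Proof.
move=> Fl Gl; apply: is_derive_eq (is_deriveM Fl Gl) _.
by rewrite row_line0.
Qed.

Lemma line_deriveD F G x i l l' : line_derive F x i l -> line_derive G x i l' ->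
  line_derive (fun y => F y + G y) x i (l + l').
Proof. by move=> Fl Gl; exact: (is_deriveD Fl Gl). Qed.

Lemma line_deriveZ a F x i l : line_derive F x i l ->
  line_derive (fun y => a * F y) x i (a * l).
Proof. by move=> Fl; exact: (is_deriveZ _ Fl). Qed.

Lemma line_derive_coord x i j : line_derive (fun y => y ord0 j) x i (j == i)%:R.
Proof.
rewrite /line_derive (_ : (fun t => _) = cst (x ord0 j) + (j == i)%:R *: id).
  apply: is_derive_eq (is_deriveD (is_derive_cst _ _ _)
    (is_deriveZ _ (is_derive_id _ _))) _.
  by rewrite add0r /GRing.scale/= mulr1.
by apply/funext => t; rewrite /row_line !mxE eqxx/= !fctE /GRing.scale/= mulrC.
Qed.

Lemma line_derive_shift F x i t l : line_derive F (row_line x i t) i l ->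
  is_derive t 1 (fun s => F (row_line x i s)) l.
Proof.
move=> Fl.
have st : is_derive t 1 (fun s => s - t) 1.
  apply: is_derive_eq (is_deriveB (is_derive_id _ _) (is_derive_cst t _ _)) _.
  by rewrite subr0.
have Fl' : is_derive (t - t) 1 (fun s => F (row_line (row_line x i t) i s)) l.
  by rewrite subrr.
have := @is_derive1_comp R (fun s => F (row_line (row_line x i t) i s))
  (fun s => s - t) t l 1 Fl' st.
rewrite mulr1 (_ : _ \o _ = fun s => F (row_line x i s))//.
by apply/funext => s /=; rewrite row_lineD addrC subrK.
Qed.

Lemma line_derive_sqr_enorm x i :
  line_derive (fun y => enorm y ^+ 2) x i (2 * x ord0 i).
Proof.
rewrite /line_derive (_ : (fun t => _) =
  cst (enorm x ^+ 2) + (2 * x ord0 i) *: id + id ^+ 2); last first.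
  by apply/funext => t; rewrite /row_line enorm_sqr_shift
    !fctE/= /GRing.scale/=; ring.
apply: is_derive_eq (is_deriveD (is_deriveD (is_derive_cst _ _ _)
  (is_deriveZ _ (is_derive_id _ _))) (is_deriveX 2 (is_derive_id _ _))) _.
by rewrite /GRing.scale/=; ring.
Qed.

Lemma line_derive_inv_enorm k x i : x != 0 ->
  line_derive (inv_enorm k) x i (- (k%:R * x ord0 i * inv_enorm k.+2 x)).
Proof.
move=> x0; have e0 : 0 < enorm x by rewrite enorm_gt0.
have s0 : Num.sqrt (enorm (row_line x i 0) ^+ 2) = enorm x.
  by rewrite row_line0 sqrtr_sqr ger0_norm ?enorm_ge0.
have d1 : line_derive (fun y => Num.sqrt (enorm y ^+ 2)) x i ((2 * enorm x)^-1
  * (2 * x ord0 i)).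
  rewrite /line_derive; apply: (@is_derive1_comp _ Num.sqrt (fun t =>
    enorm (row_line x i t) ^+ 2)); last exact: line_derive_sqr_enorm.
  rewrite -[in X in is_derive _ _ _ X]s0; apply: is_derive1_sqrt.
  by rewrite row_line0 exprn_gt0.
pose s t := Num.sqrt (enorm (row_line x i t) ^+ 2).
have sk0 : (s ^+ k) 0 != 0 by rewrite fctE /s s0 expf_neq0// gt_eqF.
rewrite /line_derive (_ : (fun t => _) = fun t => ((s ^+ k) t)^-1); last first.
  apply/funext => t; rewrite fctE /s sqrtr_sqr ger0_norm ?enorm_ge0//.
apply: is_derive_eq (is_deriveV sk0 (is_deriveX k d1)) _.
rewrite fctE /s s0 /GRing.scale/= /inv_enorm.
case: k {sk0} => [|k]; first by rewrite !(mul0r, mulr0, oppr0).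
rewrite !exprS/=.
by field; rewrite ?expf_neq0 gt_eqF.
Qed.

Lemma line_derive_one_sub_sqr x i :
  line_derive (fun y => 1 - enorm y ^+ 2) x i (- (2 * x ord0 i)).
Proof.
rewrite (_ : (fun y => _) = (fun y => 1 + (-1) * enorm y ^+ 2)); last first.
  by apply/funext => y; rewrite mulN1r.
apply: line_derive_eq.
  apply: line_deriveD; first exact: is_derive_cst.
  by apply: line_deriveZ; exact: line_derive_sqr_enorm.
by rewrite add0r mulN1r.
Qed.

Lemma line_derive_shifted F x z i l : line_derive F (x - z) i l ->
  line_derive (fun y => F (y - z)) x i l.
Proof.
rewrite /line_derive (_ : (fun t => F (row_line x i t - z)) = fun t =>
  F (row_line (x - z) i t))//.
by apply/funext => t; rewrite /row_line addrAC.
Qed.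

(** The first and second derivatives of the kernel along the [i]-th axis. *)
Definition kernel_d1 i x z : R :=
  - (2 * x ord0 i) * inv_enorm n (x - z)
  - (1 - enorm x ^+ 2) * (n%:R * (x - z) ord0 i * inv_enorm n.+2 (x - z)).

Definition kernel_d2 i x z : R :=
  - 2 * inv_enorm n (x - z)
  + 4 * n%:R * (x ord0 i * (x - z) ord0 i) * inv_enorm n.+2 (x - z)
  - n%:R * (1 - enorm x ^+ 2)
    * (inv_enorm n.+2 (x - z) - n.+2%:R * (x - z) ord0 i ^+ 2 * inv_enorm n.+4
      (x - z)).

Lemma line_derive_poisson_kernel i x z : x != z ->
  line_derive (poisson_kernel ^~ z) x i (kernel_d1 i x z).
Proof.
rewrite -subr_eq0 => xz; rewrite /poisson_kernel.
apply: line_derive_eq.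
  apply: line_deriveM; first exact: line_derive_one_sub_sqr.
  by apply: (@line_derive_shifted (inv_enorm n)); exact: line_derive_inv_enorm.
by rewrite /kernel_d1 /inv_enorm; ring.
Qed.

Lemma line_derive_kernel_d1 i x z : x != z ->
  line_derive (kernel_d1 i ^~ z) x i (kernel_d2 i x z).
Proof.
rewrite -subr_eq0 => xz; rewrite /kernel_d1.
rewrite (_ : (fun y => _) = (fun y : 'rV[R]_n => (-2 * y ord0 i) * inv_enorm n
  (y - z)
  + (- n%:R) * ((1 - enorm y ^+ 2) * ((y - z) ord0 i * inv_enorm n.+2
    (y - z))))); last first.
  by apply/funext => y; ring.
have dE k : line_derive (fun y => inv_enorm k (y - z)) x i
    (- (k%:R * (x - z) ord0 i * inv_enorm k.+2 (x - z))).
  by apply: line_derive_shifted; exact: line_derive_inv_enorm.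
apply: line_derive_eq.
  apply: line_deriveD.
    apply: line_deriveM; last exact: dE.
    by apply: line_deriveZ; exact: line_derive_coord.
  apply: line_deriveZ; apply: line_deriveM;
    first exact: line_derive_one_sub_sqr.
  apply: line_deriveM; last exact: dE.
  by apply: (@line_derive_shifted (fun y : 'rV[R]_n => y ord0 i));
    exact: line_derive_coord.
by rewrite /kernel_d2 eqxx (_ : true%:R = 1 :> R)//; ring.
Qed.

(** The Poisson kernel is harmonic off its pole: with [y = x - z] the sum
    is a multiple of [|y|^2 - 2 x.y - 1 + |x|^2], which vanishes because
    [|z| = 1]. *)
Lemma sum_kernel_d2 x z : esphere z -> x != z ->
  \sum_(i < n) kernel_d2 i x z = 0.
Proof.
move=> Sz; rewrite -subr_eq0 => xz; have y0 : 0 < enorm (x - z)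
  by rewrite enorm_gt0.
set y := x - z in xz y0 *.
rewrite (eq_bigr (fun i => (- 2 * inv_enorm n y - n%:R * (1 - enorm x ^+ 2)
  * inv_enorm n.+2 y)
   + ((4 * n%:R * inv_enorm n.+2 y) * (x ord0 i * y ord0 i)
   + (n%:R * (1 - enorm x ^+ 2) * n.+2%:R * inv_enorm n.+4 y) * (y ord0 i * y
     ord0 i)))); last first.
  by move=> i _; rewrite /kernel_d2 -/y; ring.
rewrite !big_split/= -!mulr_sumr -/(dot x y) -/(dot y y) !sumr_const !card_ord.
have natM (c : R) : c *+ n = n%:R * c by rewrite mulr_natl.
rewrite (natM (inv_enorm n y)) (natM (- _)).
have xyS : enorm (x - y) = 1 by rewrite /y opprB addrC subrK.
clearbody y.
have E4 : inv_enorm n.+4 y = inv_enorm n y / enorm y ^+ 4.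
  by rewrite /inv_enorm -addn4 exprD invfM.
have E2 : inv_enorm n.+2 y = inv_enorm n y / enorm y ^+ 2.
  by rewrite /inv_enorm -addn2 exprD invfM.
have xy : 2 * dot x y = enorm y ^+ 2 + enorm x ^+ 2 - 1.
  have : enorm (x - y) ^+ 2 = 1 by rewrite xyS expr1n.
  rewrite -dotE_enorm !(dotBl, dotBr) !dotE_enorm (dotC y x); lra.
have -> : dot x y = (enorm y ^+ 2 + enorm x ^+ 2 - 1) / 2 by lra.
have n2 : n.+2%:R = n%:R + 2 :> R by rewrite -addn2 natrD.
rewrite dotE_enorm E4 E2 n2.
by field; rewrite gt_eqF.
Qed.

End kernel_derivatives.

(** * Poisson integrals *)

Section bounded_measurable.
Context {R : realType} {n : nat}.
Hypothesis n_gt0 : (0 < n)%N.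
Local Notation sigma := (@sphere_measure R n).
Implicit Types (f g : 'rV[R]_n -> R) (a : R).

(** Since the sphere has finite measure, these functions are integrable; they
    form an algebra, so the rules of integration below apply to any expression
    built from them. *)
Definition bounded_measurable f : Prop :=
  measurable_fun esphere (f : _ -> measurableTypeR R) /\
  exists M, forall z, esphere z -> `|f z| <= M.

Lemma bounded_measurable_cst a : bounded_measurable (fun=> a).
Proof. by split; [exact: measurable_cst|exists `|a|]. Qed.

Lemma bounded_measurableD f g : bounded_measurable f -> bounded_measurable g ->
  bounded_measurable (fun z => f z + g z).
Proof.
move=> [mf [M fM]] [mg [K gK]]; split; first exact: measurable_funD.
by exists (M + K) => z Sz; rewrite (le_trans (ler_normD _ _))// lerD ?fM ?gK.
Qed.

Lemma bounded_measurableM f g : bounded_measurable f -> bounded_measurable g ->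
  bounded_measurable (fun z => f z * g z).
Proof.
move=> [mf [M fM]] [mg [K gK]]; split; first exact: measurable_funM.
by exists (M * K) => z Sz; rewrite normrM ler_pM ?fM ?gK.
Qed.

Lemma bounded_measurableZ a f : bounded_measurable f ->
  bounded_measurable (fun z => a * f z).
Proof. by apply: bounded_measurableM; exact: bounded_measurable_cst. Qed.

Lemma bounded_measurableB f g : bounded_measurable f -> bounded_measurable g ->
  bounded_measurable (fun z => f z - g z).
Proof.
move=> bf bg; under [X in bounded_measurable X]eq_fun do rewrite -mulN1r.
by apply: bounded_measurableD => //; exact: bounded_measurableZ.
Qed.

Lemma bounded_measurable_norm f : bounded_measurable f ->
  bounded_measurable (fun z => `|f z|).
Proof.
move=> [mf [M fM]]; split; first exact: (measurableT_comp (@normr_measurable R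
  setT)).
by exists M => z Sz; rewrite normr_id fM.
Qed.

Lemma bounded_measurable_sum (I : Type) (s : seq I) (F : I -> 'rV[R]_n -> R) :
  (forall i, bounded_measurable (F i)) ->
  bounded_measurable (fun z => \sum_(i <- s) F i z).
Proof.
move=> bF; elim: s => [|i s IH].
  by under eq_fun do rewrite big_nil; exact: bounded_measurable_cst.
by under eq_fun do rewrite big_cons; exact: bounded_measurableD.
Qed.

Lemma bounded_measurable_integrable f : bounded_measurable f ->
  sigma.-integrable esphere (EFin \o f).
Proof. by move=> [mf [M fM]]; exact: integrable_sphere fM. Qed.

Lemma sphere_integralD f g : bounded_measurable f -> bounded_measurable g ->
  \int[sigma]_(z in esphere) (f z + g z) =
  \int[sigma]_(z in esphere) f z + \int[sigma]_(z in esphere) g z.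
Proof.
move=> bf bg; rewrite RintegralD//; [exact: measurable_esphere| |];
  exact: bounded_measurable_integrable.
Qed.

Lemma sphere_integralZ a f : bounded_measurable f ->
  \int[sigma]_(z in esphere) (a * f z) = a * \int[sigma]_(z in esphere) f z.
Proof.
move=> bf; rewrite RintegralZl//; first exact: measurable_esphere.
exact: bounded_measurable_integrable.
Qed.

Lemma sphere_integralB f g : bounded_measurable f -> bounded_measurable g ->
  \int[sigma]_(z in esphere) (f z - g z) =
  \int[sigma]_(z in esphere) f z - \int[sigma]_(z in esphere) g z.
Proof.
move=> bf bg; rewrite RintegralB//; [exact: measurable_esphere| |];
  exact: bounded_measurable_integrable.
Qed.

Lemma sphere_integral_sum (I : Type) (s : seq I) (F : I -> 'rV[R]_n -> R) :
  (forall i, bounded_measurable (F i)) ->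
  \int[sigma]_(z in esphere) (\sum_(i <- s) F i z) =
  \sum_(i <- s) \int[sigma]_(z in esphere) F i z.
Proof.
move=> bF; elim: s => [|i s IH].
  rewrite big_nil; under eq_Rintegral do rewrite big_nil.
  exact: Rintegral_sphere_cst.
rewrite big_cons -IH -sphere_integralD//; last exact: bounded_measurable_sum.
by apply: eq_Rintegral => z _; rewrite big_cons.
Qed.

Lemma le_sphere_integral f g : bounded_measurable f -> bounded_measurable g ->
  (forall z, esphere z -> f z <= g z) ->
  \int[sigma]_(z in esphere) f z <= \int[sigma]_(z in esphere) g z.
Proof.
move=> bf bg fg; apply: le_Rintegral => //; first exact: measurable_esphere;
  exact: bounded_measurable_integrable.
Qed.

Lemma normr_sphere_integral f : bounded_measurable f ->
  `|\int[sigma]_(z in esphere) f z| <= \int[sigma]_(z in esphere) `|f z|.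
Proof.
move=> bf; apply: le_normr_Rintegral; first exact: measurable_esphere.
exact: bounded_measurable_integrable.
Qed.

Lemma sphere_integral_cvg (F : nat -> 'rV[R]_n -> R) f (M : R) :
  (forall k, measurable_fun esphere (F k : _ -> measurableTypeR R)) ->
  measurable_fun esphere (f : _ -> measurableTypeR R) ->
  (forall k z, esphere z -> `|F k z| <= M) ->
  (forall z, esphere z -> F ^~ z @ \oo --> f z) ->
  (fun k => \int[sigma]_(z in esphere) F k z) @ \oo -->
    \int[sigma]_(z in esphere) f z.
Proof.
move=> mF mf FM Ff; have mS := @measurable_esphere R n.
have [] := @dominated_convergence _ _ _ sigma esphere mS
  (fun k => EFin \o F k) (EFin \o f) (cst M%:E).
- by move=> k; apply/measurable_EFinP; exact: mF.
- by apply/measurable_EFinP; exact: mf.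
- by apply: aeW => z Sz; apply: cvg_EFin; [exact: nearW|exact: Ff].
- exact: (bounded_measurable_integrable (bounded_measurable_cst M)).
- by apply: aeW => z k Sz /=; rewrite lee_fin FM.
move=> fi _ Fi; apply: fine_cvg; rewrite fineK//.
exact: integrable_fin_num.
Qed.

End bounded_measurable.

Section kernel_bounds.
Context {R : realType} {n : nat}.
Implicit Types (x z : 'rV[R]_n) (i : 'I_n) (d : R).

Lemma sphere_dist x z : esphere z -> 1 - enorm x <= enorm (x - z).
Proof.
move=> Sz; have := ler_enorm_dist z x; rewrite Sz enormBC.
by apply: le_trans; exact: ler_norm.
Qed.

Lemma inv_enorm_ge0 k x : 0 <= inv_enorm k x.
Proof. by rewrite invr_ge0 exprn_ge0// enorm_ge0. Qed.

Lemma inv_enorm_le k x d : 0 < d -> d <= enorm x ->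
  inv_enorm k x <= (d ^+ k)^-1.
Proof.
move=> d0 dx; have x0 := lt_le_trans d0 dx.
rewrite /inv_enorm lef_pV2 ?posrE ?exprn_gt0//.
by apply: lerXn2r => //; rewrite nnegrE ltW.
Qed.

Lemma poisson_kernel_ge0 x z : ecball x -> 0 <= poisson_kernel x z.
Proof.
move=> x1; rewrite /poisson_kernel divr_ge0 ?exprn_ge0 ?enorm_ge0//.
by rewrite subr_ge0 exprn_ile1// enorm_ge0.
Qed.

Lemma poisson_kernel_le x z d : 0 < d -> ecball x -> d <= enorm (x - z) ->
  poisson_kernel x z <= (1 - enorm x ^+ 2) * (d ^+ n)^-1.
Proof.
move=> d0 x1 dxz; rewrite /poisson_kernel ler_wpM2l ?subr_ge0 ?exprn_ile1
  ?enorm_ge0//.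
exact: inv_enorm_le.
Qed.

Lemma measurable_poisson_kernel x :
  measurable_fun setT (poisson_kernel x : _ -> measurableTypeR R).
Proof.
rewrite (_ : poisson_kernel x =
  fun z => (1 - enorm x ^+ 2) * (enorm (z - x) ^+ n) `^ (-1)); last first.
  by apply/funext => z; rewrite powR_inv1 ?exprn_ge0 ?enorm_ge0// enormBC.
apply: measurable_funM => //.
apply: (measurableT_comp (f := fun r : R => r `^ (-1)));
  first exact: measurable_powR.
apply: measurable_funX; apply: (measurableT_comp measurable_enorm).
exact: measurable_rowD.
Qed.

Lemma bounded_measurable_kernel x : eball x ->
  bounded_measurable (poisson_kernel x).
Proof.
move=> bx; split; first by apply: measurable_funTS;
  exact: measurable_poisson_kernel.
have d0 : 0 < 1 - enorm x by rewrite subr_gt0.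
exists ((1 - enorm x ^+ 2) * ((1 - enorm x) ^+ n)^-1) => z Sz.
rewrite ger0_norm ?poisson_kernel_ge0//; last exact: ltW bx.
by apply: poisson_kernel_le => //; [exact: ltW bx|exact: sphere_dist].
Qed.

(** For [x] in the ball, [z] on the sphere and [y = x - z], the crude bounds
    [|x_i| <= 1], [|y_i| <= 2] and [1 - |x|^2 <= 1] are inserted in each term of
    [kernel_d2], and [d] bounds [|y|] from below. *)
Definition kernel_d2_bound d : R :=
  2 * (d ^+ n)^-1 + 8 * n%:R * (d ^+ n.+2)^-1
  + n%:R * ((d ^+ n.+2)^-1 + n.+2%:R * 4 * (d ^+ n.+4)^-1).

Lemma kernel_d2_le i x z d : 0 < d -> ecball x -> esphere z ->
  d <= enorm (x - z) -> `|kernel_d2 i x z| <= kernel_d2_bound d.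
Proof.
move=> d0 x1 Sz dxz.
have E0 := inv_enorm_le n d0 dxz; have E2 := inv_enorm_le n.+2 d0 dxz.
have E4 := inv_enorm_le n.+4 d0 dxz.
have xi : `|x ord0 i| <= 1 := le_trans (coord_le_enorm _ _) x1.
have yi : `|(x - z) ord0 i| <= 2.
  rewrite (le_trans (coord_le_enorm _ _))// (le_trans (ler_enormD _ _))//.
  by rewrite enormN Sz; move: x1; rewrite /ecball/=; lra.
have p1 : `|1 - enorm x ^+ 2| <= 1.
  rewrite ger0_norm ?subr_ge0 ?exprn_ile1 ?enorm_ge0// gerBl.
  by rewrite exprn_ge0// enorm_ge0.
have nE k : `|inv_enorm k (x - z)| = inv_enorm k (x - z).
  by rewrite ger0_norm// inv_enorm_ge0.
rewrite /kernel_d2 /kernel_d2_bound.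
apply: le_trans (ler_normB _ _) _; apply: lerD.
  apply: le_trans (ler_normD _ _) _; apply: lerD.
    by rewrite normrM nE normrN (ger0_norm (_ : 0 <= 2))// ler_pM2l.
  rewrite !normrM nE ler_pM ?mulr_ge0 ?inv_enorm_ge0//.
  rewrite (ger0_norm (_ : 0 <= 4))// (ger0_norm (_ : 0 <= n%:R))//.
  rewrite (_ : 8 * n%:R = 4 * n%:R * (1 * 2)); last by ring.
  by rewrite ler_pM ?mulr_ge0// ler_pM.
rewrite normrM [X in _ <= X](_ : _ = n%:R * 1 * ((d ^+ n.+2)^-1 + n.+2%:R * 4
  * (d ^+ n.+4)^-1)); last by rewrite mulr1.
apply: ler_pM => //.
  by rewrite normrM (ger0_norm (_ : 0 <= n%:R))// ler_pM.
apply: le_trans (ler_normB _ _) _; apply: lerD; first by rewrite nE.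
rewrite !normrM nE ler_pM ?mulr_ge0 ?inv_enorm_ge0//.
rewrite (ger0_norm (_ : 0 <= n.+2%:R))// ler_pM//.
by rewrite (_ : 4 = 2 * 2); [rewrite ler_pM|ring].
Qed.

End kernel_bounds.

Section poisson_harmonic.
Context {R : realType} {n : nat}.
Hypothesis n_gt0 : (0 < n)%N.
Local Notation sigma := (@sphere_measure R n).
Implicit Types (psi : 'rV[R]_n -> R) (x z : 'rV[R]_n) (i : 'I_n).

(** A displacement of this length from [x] stays in the ball, at this distance
    at least from the sphere: on such displacements the kernel and its
    derivatives are bounded uniformly in the pole. *)
Definition half_gap x : R := (1 - enorm x) / 2.

Lemma half_gap_gt0 x : eball x -> 0 < half_gap x.
Proof. by move=> bx; rewrite divr_gt0// subr_gt0. Qed.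

Lemma near_eball x y : eball x -> enorm (y - x) <= half_gap x ->
  eball y /\ forall z, esphere z -> half_gap x <= enorm (y - z).
Proof.
rewrite /half_gap => bx yx; have : enorm y <= enorm x + (1 - enorm x) / 2.
  by have := ler_enormD (y - x) x; rewrite subrK; lra.
move: bx; rewrite /eball/= => bx yl; split; first by lra.
by move=> z Sz; have := sphere_dist y Sz; lra.
Qed.

Lemma row_line_near x i t : eball x -> `|t| <= half_gap x ->
  eball (row_line x i t) /\
  forall z, esphere z -> half_gap x <= enorm (row_line x i t - z).
Proof. by move=> bx tx; apply: near_eball; rewrite ?enorm_row_line_sub. Qed.

Lemma eball_neq_esphere x z : eball x -> esphere z -> x != z.
Proof.
by move=> bx Sz; apply/eqP => xz; move: bx; rewrite xz /eball/= Sz ltxx.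
Qed.

Lemma kernel_second_quotient_le x z (h : R) : eball x -> esphere z ->
  0 < h -> h <= half_gap x ->
  `|second_quotient (poisson_kernel ^~ z) x h|
  <= n%:R * @kernel_d2_bound R n (half_gap x).
Proof.
move=> bx Sz h0 hx; apply: le_trans (ler_norm_sum _ _ _) _.
apply: (@le_trans _ _ (\sum_(i < n) @kernel_d2_bound R n (half_gap x)));
  last first.
  by rewrite sumr_const card_ord mulr_natl.
apply: ler_sum => i _.
have g0 : forall t : R, `|t| <= h -> is_derive t 1
    (fun s => poisson_kernel (row_line x i s) z) (kernel_d1 i (row_line x i t)
      z).
  move=> t th; apply: (@line_derive_shift _ _ (poisson_kernel ^~ z));
    apply: line_derive_poisson_kernel.
  by apply: eball_neq_esphere => //;
    apply: (row_line_near i bx (le_trans th hx)).1.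
have g1 : forall t : R, `|t| <= h -> is_derive t 1
    (fun s => kernel_d1 i (row_line x i s) z) (kernel_d2 i (row_line x i t) z).
  move=> t th; apply: (@line_derive_shift _ _ (kernel_d1 i ^~ z));
    apply: line_derive_kernel_d1.
  by apply: eball_neq_esphere => //;
    apply: (row_line_near i bx (le_trans th hx)).1.
have [c ch] := second_difference_mvt2 h0 g0 g1; rewrite row_line0 => ->.
have [/ltW bc cz] := row_line_near i bx (le_trans ch hx).
apply: kernel_d2_le => //; [exact: half_gap_gt0|exact: cz].
Qed.

Lemma kernel_has_laplacian x z : eball x -> esphere z ->
  has_laplacian (poisson_kernel ^~ z) x 0.
Proof.
move=> bx Sz; rewrite -(sum_kernel_d2 Sz (eball_neq_esphere bx Sz)).
apply: (@cvg_big R 'I_n +%R 0 xpredT (@add_continuous _) nat \oo (index_enum _)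
  (fun i k => (poisson_kernel (row_line x i (harmonic k)) z
     + poisson_kernel (row_line x i (- harmonic k)) z - 2 * poisson_kernel x z)
       / harmonic k ^+ 2)) => i _.
have := @second_difference_cvg R (fun t => poisson_kernel (row_line x i t) z)
  (fun t => kernel_d1 i (row_line x i t) z) (kernel_d2 i x z) (half_gap x)
    (half_gap_gt0 bx).
rewrite row_line0; apply.
  move=> t tx; apply: (@line_derive_shift _ _ (poisson_kernel ^~ z));
    apply: line_derive_poisson_kernel.
  by apply: eball_neq_esphere => //; apply: (row_line_near i bx tx).1.
by apply: line_derive_kernel_d1; exact: eball_neq_esphere.
Qed.

Lemma poisson_second_quotient psi x (h : R) :
  bounded_measurable psi -> eball x -> 0 < h -> h <= half_gap x ->
  \int[sigma]_(z in esphere) (second_quotient (poisson_kernel ^~ z) x h * psi z)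
  = second_quotient (poisson psi) x h.
Proof.
move=> bpsi bx h0 hx.
have bP i t : `|t| <= h -> bounded_measurable (fun z => poisson_kernel
  (row_line x i t) z * psi z).
  move=> th; apply: bounded_measurableM => //; apply: bounded_measurable_kernel.
  exact: (row_line_near i bx (le_trans th hx)).1.
have bP0 : bounded_measurable (fun z => poisson_kernel x z * psi z).
  by apply: bounded_measurableM => //; exact: bounded_measurable_kernel.
have hh : `|h| <= h by rewrite gtr0_norm.
have hN : `|- h| <= h by rewrite normrN gtr0_norm.
pose D i z := poisson_kernel (row_line x i h) z * psi z
  + poisson_kernel (row_line x i (- h)) z * psi z - 2 * (poisson_kernel x z
    * psi z).
have bD i : bounded_measurable (D i).
  by apply: bounded_measurableB; [apply: bounded_measurableD;
    exact: bP|exact: bounded_measurableZ].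
transitivity (\int[sigma]_(z in esphere) (\sum_(i < n) (h ^+ 2)^-1 * D i z)).
  apply: eq_Rintegral => z _; rewrite /second_quotient mulr_suml.
  by apply: eq_bigr => i _; rewrite /D; ring.
rewrite sphere_integral_sum//; last by move=> i; exact: bounded_measurableZ.
apply: eq_bigr => i _; rewrite sphere_integralZ// mulrC; congr (_ / _).
have b1 := bP i h hh; have b2 := bP i (- h) hN.
rewrite /D sphere_integralB//;
  [|exact: bounded_measurableD|exact: bounded_measurableZ].
by rewrite sphere_integralD// sphere_integralZ.
Qed.

(** The second difference quotients of the kernel are bounded uniformly on the
    sphere and converge to its Laplacian, which is zero. *)
Lemma poisson_has_laplacian psi x : bounded_measurable psi -> eball x ->
  has_laplacian (poisson psi) x 0.
Proof.
move=> bpsi bx; have [mpsi [M psiM]] := bpsi.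
(* The quotients are dominated only once the step is below [half_gap x]. *)
have [N _ NP] : \forall k \near \oo, harmonic k <= half_gap x.
  have /cvgrPdist_le/(_ _ (half_gap_gt0 bx)) := @cvg_harmonic R.
  by apply: filterS => k; rewrite sub0r normrN gtr0_norm ?harmonic_gt0.
have hN k : harmonic (k + N)%N <= half_gap x by apply: NP => /=;
  exact: leq_addl.
rewrite /has_laplacian -(cvg_shiftn N).
pose F k z := second_quotient (poisson_kernel ^~ z) x (harmonic (k + N)%N)
  * psi z.
rewrite (_ : (fun k => _) = fun k => \int[sigma]_(z in esphere) F k z);
  last first.
  apply/funext => k; apply/esym; apply: poisson_second_quotient => //.
  exact: harmonic_gt0.
suff : (fun k => \int[sigma]_(z in esphere) F k z) @ \oo -->
    \int[sigma]_(z in esphere) (0 : R) by rewrite Rintegral_sphere_cst.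
apply: (@sphere_integral_cvg _ _ n_gt0 F _ (n%:R * @kernel_d2_bound R n
  (half_gap x) * M)).
- move=> k; apply: measurable_funM => //; apply: measurable_funTS.
  apply: measurable_sum => i; apply: measurable_funM => //.
  apply: measurable_funB; last by apply: measurable_funM => //;
    exact: measurable_poisson_kernel.
  by apply: measurable_funD; exact: measurable_poisson_kernel.
- exact: measurable_cst.
- move=> k z Sz; rewrite normrM ler_pM ?psiM//.
  by apply: kernel_second_quotient_le => //; exact: harmonic_gt0.
- move=> z Sz; suff : F ^~ z @ \oo --> 0 * psi z by rewrite mul0r.
  apply: cvgMr_tmp; have := kernel_has_laplacian bx Sz; rewrite /has_laplacian.
  by rewrite -(cvg_shiftn N).
Qed.

Lemma continuous_poisson_kernel x z : x != z ->
  {for x, continuous (poisson_kernel ^~ z)}.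
Proof.
move=> xz.
have c1 : {for x, continuous (fun y : 'rV[R]_n => (1 - enorm y ^+ 2))}.
  apply: (@continuous_comp _ _ _ enorm (fun r : R => 1 - r ^+ 2));
    first exact: enorm_continuous.
  by apply: cvgB; [exact: cvg_cst|exact: exprn_continuous].
have c2 : {for x, continuous (fun y : 'rV[R]_n => (enorm (y - z) ^+ n)^-1)}.
  apply: (@continuous_comp _ _ _ (fun y : 'rV[R]_n => y - z) (fun u :
    'rV[R]_n => (enorm u ^+ n)^-1)).
    exact: (@continuousB _ _ _ id (cst z) x (@cvg_id _ _) (@cst_continuous _ _
      _ _)).
  apply: (@continuous_comp _ _ _ enorm (fun r : R => (r ^+ n)^-1));
    first exact: enorm_continuous.
  apply: continuousV; last exact: exprn_continuous.
  by rewrite expf_neq0// gt_eqF// enorm_gt0 subr_eq0.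
exact: (@continuousM _ _ (fun y : 'rV[R]_n => (1 - enorm y ^+ 2)) (fun y :
  'rV[R]_n => (enorm (y - z) ^+ n)^-1) x c1 c2).
Qed.

(** A failure of continuity would give a sequence converging to [x] along which
    dominated convergence fails. *)
Lemma poisson_continuous psi x : bounded_measurable psi -> eball x ->
  {for x, continuous (poisson psi)}.
Proof.
move=> bpsi bx; have [mpsi [M psiM]] := bpsi.
apply/continuous_enormP => e e0; apply: contrapT => noD.
have xkP k : exists y, enorm (y - x) <= half_gap x /\ enorm (y - x) < harmonic
  k /\ e <= `|poisson psi y - poisson psi x|.
  apply: contrapT => no; apply: noD;
    exists (Order.min (half_gap x) (harmonic k)).
    by rewrite lt_min half_gap_gt0// harmonic_gt0.
  move=> y; rewrite lt_min => /andP[yd yk]; rewrite ltNge; apply/negP => ey.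
  by apply: no; exists y; split=> //; exact: ltW.
have [y yP] := choice xkP.
suff : (fun k => poisson psi (y k)) @ \oo --> poisson psi x.
  move/cvgrPdist_lt/(_ e e0) => [k _ /(_ k (leqnn _))]/=.
  by rewrite distrC ltNge (yP k).2.2.
apply: (@sphere_integral_cvg _ _ n_gt0 _ _ (1 * ((half_gap x) ^+ n)^-1 * M)).
- by move=> k; apply: measurable_funM => //; apply: measurable_funTS;
  exact: measurable_poisson_kernel.
- by apply: measurable_funM => //; apply: measurable_funTS;
  exact: measurable_poisson_kernel.
- move=> k z Sz; have [yb yz] := near_eball bx (yP k).1.
  rewrite normrM ler_pM ?psiM// ger0_norm ?poisson_kernel_ge0//;
    last exact: ltW yb.
  apply: le_trans (poisson_kernel_le (half_gap_gt0 bx) (ltW yb) (yz _ Sz)) _.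
  apply: ler_wpM2r; first by rewrite invr_ge0 exprn_ge0// ltW// half_gap_gt0.
  by rewrite gerBl exprn_ge0// enorm_ge0.
- move=> z Sz; apply: cvgMr_tmp; apply/cvgrPdist_lt => r r0.
  have /continuous_enormP/(_ _ r0)[d d0 dP] := continuous_poisson_kernel
    (eball_neq_esphere bx Sz).
  have /cvgrPdist_lt/(_ d d0) := @cvg_harmonic R.
  apply: filterS => k; rewrite sub0r normrN gtr0_norm ?harmonic_gt0// => kd.
  by rewrite distrC dP// (lt_trans (yP k).2.1).
Qed.

End poisson_harmonic.

(** * The maximum principle and the Dirichlet problem *)

Section maximum_principle.
Context {R : realType} {n : nat}.
Hypothesis n_gt0 : (0 < n)%N.
Implicit Types (w : 'rV[R]_n -> R) (x z : 'rV[R]_n) (r C : R).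

(** At an interior maximum every second difference is nonpositive, hence so is
    the Laplacian.  Adding a small multiple of [|x|^2 - 1] makes the Laplacian
    positive, so the maximum is on the sphere. *)
Lemma maximum_principle w r C : 0 <= r ->
  {within [set x | enorm x <= r], continuous w} ->
  (forall x, enorm x < r -> exists2 L, 0 <= L & has_laplacian w x L) ->
  (forall z, enorm z = r -> w z <= C) ->
  forall x, enorm x <= r -> w x <= C.
Proof.
move=> r0 cw lw wC x xr; apply/ler_addgt0Pr => e e0.
pose eps := e / (r ^+ 2 + 1).
have r1 : 0 < r ^+ 2 + 1 by rewrite ltr_wpDl// sqr_ge0.
have eps0 : 0 < eps by rewrite divr_gt0.
pose W y := w y + eps * (enorm y ^+ 2 - 1).
have cW : {within [set x | enorm x <= r], continuous W}.
  apply/subspace_continuousP => y yr; apply: cvgD.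
    by move/subspace_continuousP : cw; exact.
  apply: cvg_within_filter.
  apply: (@continuous_comp _ _ _ (@enorm R n) (fun s : R =>
    eps * (s ^+ 2 - 1))); first exact: enorm_continuous.
  by apply: cvgMl_tmp; apply: cvgB; [exact: exprn_continuous|exact: cvg_cst].
have [|c] := EVT_max_rV _ (@compact_ball R n r) cW; first by exists x.
rewrite inE /= => cr cmax.
have Wx : W x <= W c by apply: cmax; rewrite inE.
have Wc : W c <= C + eps * (r ^+ 2 - 1).
  move: cr; rewrite le_eqVlt => /orP[/eqP cr|cr].
    by rewrite /W cr lerD2r wC.
  have [L L0 wL] := lw c cr.
  have WL : has_laplacian W c (L + eps * (2 * n%:R)).
    apply: has_laplacianD wL _; apply: has_laplacianZ.
    exact: has_laplacian_sqr_enorm.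
  suff : L + eps * (2 * n%:R) <= 0.
    by rewrite leNgt ltr_wpDl// mulr_gt0// mulr_gt0// ltr0n.
  apply: (cvgr_to_le WL).
  have /cvgrPdist_le/(_ (r - enorm c)) := @cvg_harmonic R.
  rewrite subr_gt0 => /(_ cr); apply: filterS => k.
  rewrite sub0r normrN gtr0_norm ?harmonic_gt0// => kr.
  apply: sumr_le0 => i _; apply: mulr_le0_ge0; last by rewrite invr_ge0 sqr_ge0.
  have Wi t : `|t| <= harmonic k -> W (row_line c i t) <= W c.
    move=> tk; apply: cmax; rewrite inE/= (le_trans (ler_enormD _ _))//.
    by rewrite enormZ enorm_delta mulr1 -lerBrDl (le_trans tk).
  have := Wi (harmonic k); have := Wi (- harmonic k).
  rewrite normrN gtr0_norm ?harmonic_gt0// => /(_ (lexx _)) h1 /(_ (lexx _)) h2.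
  by rewrite subr_le0; lra.
have : w x <= C + eps * (r ^+ 2 - enorm x ^+ 2) by move: Wx;
  rewrite /W in Wc *; lra.
move/le_trans; apply; rewrite lerD2l.
apply: (@le_trans _ _ (eps * (r ^+ 2 + 1))); last by rewrite divfK ?gt_eqF.
by rewrite ler_pM2l//; have := sqr_ge0 (enorm x); lra.
Qed.

End maximum_principle.

Section dirichlet.
Context {R : realType} {n : nat}.
Hypothesis n_gt0 : (0 < n)%N.
Local Notation sigma := (@sphere_measure R n).
Implicit Types (psi : 'rV[R]_n -> R) (x z : 'rV[R]_n).

Lemma poisson_kernel0 z : esphere z -> poisson_kernel 0 z = 1.
Proof.
by move=> Sz; rewrite /poisson_kernel sub0r enormN enorm0 Sz expr0n expr1n
  subr0 divr1.
Qed.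

Lemma poisson0 psi : poisson psi 0 = \int[sigma]_(z in esphere) psi z.
Proof.
by apply: eq_Rintegral => z; rewrite inE => Sz; rewrite poisson_kernel0// mul1r.
Qed.

Lemma poisson_kernel_reflect w x z :
  poisson_kernel (reflect_along w x) (reflect_along w z) = poisson_kernel x z.
Proof. by rewrite /poisson_kernel -reflectB !enorm_reflect. Qed.

Lemma sphere_integral_reflect w psi : bounded_measurable psi ->
  \int[sigma]_(z in esphere) psi (reflect_along w z)
  = \int[sigma]_(z in esphere) psi z.
Proof. by move=> [mpsi [M psiM]]; exact: Rintegral_sphere_reflect psiM. Qed.

(** The mass of the kernel is rotation invariant, so it is constant on the
    sphere through [x]; being harmonic, it is constant inside that sphere, and
    it is 1 at the centre. *)
Lemma poisson_one x : eball x -> poisson (fun=> 1) x = 1.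
Proof.
move=> bx; have b1 := @bounded_measurable_cst R n 1.
pose u := poisson (fun=> 1 : R) : 'rV[R]_n -> R.
have u0 : u 0 = 1 by rewrite /u poisson0 Rintegral_sphere_cst.
have uS z : enorm z = enorm x -> u z = u x.
  move=> zx; have bz : eball z by rewrite /eball/= zx.
  rewrite /u /poisson -(@sphere_integral_reflect (x - z)).
    apply: eq_Rintegral => y _; congr (_ * _).
    by rewrite -[X in poisson_kernel X _ = _](reflect_swap (esym zx))
      poisson_kernel_reflect.
  by apply: bounded_measurableM => //; exact: bounded_measurable_kernel.
have cu : {within [set y | enorm y <= enorm x], continuous u}.
  apply/subspace_continuousP => y /= yx; apply: cvg_within_filter.
  apply: poisson_continuous => //; exact: le_lt_trans yx bx.
have lu y : enorm y < enorm x -> has_laplacian u y 0.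
  move=> yx; apply: poisson_has_laplacian => //; exact: lt_trans yx bx.
have x0 : enorm (0 : 'rV[R]_n) <= enorm x by rewrite enorm0 enorm_ge0.
rewrite -[LHS]/(u x) -u0; apply/eqP; rewrite eq_le; apply/andP; split.
  suff : -1 * u 0 <= -1 * u x by rewrite !mulN1r lerN2.
  apply: (maximum_principle n_gt0 (w := fun y => -1 * u y) _ _ _ _ x0).
  - exact: enorm_ge0.
  - by apply/subspace_continuousP => y yx; apply: cvgMl_tmp;
    move/subspace_continuousP : cu; exact.
  - by move=> y yx; exists (-1 * 0); [rewrite mulr0|apply: has_laplacianZ;
    exact: lu].
  - by move=> z /uS ->.
apply: (maximum_principle n_gt0 _ cu _ _ x0).
- exact: enorm_ge0.
- by move=> y yx; exists 0; [exact: lexx|exact: lu].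
- by move=> z /uS ->.
Qed.

(** The kernel is an approximate identity: by continuity [psi] is close to
    [psi z] near [z], and away from [z] the kernel is at most a constant times
    [1 - |x|^2 <= 2 |x - z|]. *)
Lemma poisson_boundary psi z : bounded_measurable psi ->
  {within esphere, continuous psi} -> esphere z ->
  forall e, 0 < e -> exists2 d, 0 < d &
    forall x, eball x -> enorm (x - z) < d -> `|poisson psi x - psi z| <= e.
Proof.
move=> bpsi /within_continuous_enormP cpsi Sz e e0.
have [mpsi [M psiM]] := bpsi.
have M0 : 0 <= M := le_trans (normr_ge0 _) (psiM z Sz).
have e20 : 0 < e / 2 by rewrite divr_gt0.
have [d d0 dP] := cpsi z Sz (e / 2) e20.
(* The mass away from [z], times the oscillation [2 M] of [psi], is at most
   [A * |x - z|]. *)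
pose A := 2 * M * 2 * ((d / 2) ^+ n)^-1.
have A0 : 0 <= A by rewrite !mulr_ge0// invr_ge0 exprn_ge0// divr_ge0// ltW.
have A1 : 0 < A + 1 by rewrite ltr_wpDl.
exists (Order.min (d / 2) (e / 2 / (A + 1))).
  by rewrite lt_min !divr_gt0.
move=> x bx; rewrite lt_min => /andP[xd xA].
have bk := bounded_measurable_kernel bx.
have bpz : bounded_measurable (fun y => psi y - psi z).
  by apply: bounded_measurableB => //; exact: bounded_measurable_cst.
have -> : poisson psi x - psi z
    = \int[sigma]_(y in esphere) (poisson_kernel x y * (psi y - psi z)).
  rewrite -[in LHS](mulr1 (psi z)) -(poisson_one bx) /poisson
    -sphere_integralZ//; last first.
    by apply: bounded_measurableM => //; exact: bounded_measurable_cst.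
  rewrite -sphere_integralB//.
  - by apply: eq_Rintegral => y _; ring.
  - exact: bounded_measurableM.
  - by apply: bounded_measurableZ; apply: bounded_measurableM => //;
    exact: bounded_measurable_cst.
have bkz := bounded_measurableM bk bpz.
apply: le_trans (normr_sphere_integral n_gt0 bkz) _.
have bx1 : ecball x := ltW bx.
apply: (@le_trans _ _ (\int[sigma]_(y in esphere) (e / 2 * (poisson_kernel x y
  * 1) + A * enorm (x - z)))).
  apply: le_sphere_integral => //; first exact: bounded_measurable_norm.
    apply: bounded_measurableD; last exact: bounded_measurable_cst.
    by apply: bounded_measurableZ; apply: bounded_measurableM => //;
      exact: bounded_measurable_cst.
  move=> y Sy; have P0 := poisson_kernel_ge0 y bx1.
  rewrite normrM (ger0_norm P0) mulr1.
  have [yz|yz] := ltP (enorm (y - z)) d.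
    rewrite -[leLHS]addr0 lerD//; last by rewrite mulr_ge0 ?enorm_ge0.
    by rewrite mulrC ler_wpM2r// ltW// dP.
  rewrite -[leLHS]add0r lerD//; first by rewrite mulr_ge0// ltW.
  have xy : d / 2 <= enorm (x - y).
    have := ler_enormD (y - x) (x - z); rewrite addrA subrK enormBC => h; lra.
  have Pxy := poisson_kernel_le (divr_gt0 d0 (ltr0n _ 2)) bx1 xy.
  have psi2 : `|psi y - psi z| <= 2 * M.
    by rewrite (le_trans (ler_normB _ _))// mulrDl mul1r lerD ?psiM.
  apply: (@le_trans _ _ ((1 - enorm x ^+ 2) * ((d / 2) ^+ n)^-1 * (2 * M))).
    by rewrite ler_pM.
  have x2 : 1 - enorm x ^+ 2 <= 2 * enorm (x - z).
    have := sphere_dist x Sz; have := enorm_ge0 x; move: bx; rewrite /eball/=;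
      nra.
  rewrite /A (_ : 2 * M * 2 * _ * _ = (2 * enorm (x - z)) * ((d / 2) ^+ n)^-1
    * (2 * M)); last by ring.
  have d2 : 0 <= ((d / 2) ^+ n)^-1 by rewrite invr_ge0 exprn_ge0// divr_ge0//
    ltW.
  by rewrite ler_wpM2r ?mulr_ge0// ler_wpM2r.
have bk1 : bounded_measurable (fun y => poisson_kernel x y * 1).
  by apply: bounded_measurableM => //; exact: bounded_measurable_cst.
apply: (@le_trans _ _ (e / 2 * poisson (fun=> 1) x + A * enorm (x - z))).
  rewrite le_eqVlt; apply/orP; left; apply/eqP;
    rewrite /poisson -sphere_integralZ//.
  transitivity (\int[sigma]_(y in esphere) (e / 2 * (poisson_kernel x y * 1))
    + \int[sigma]_(y in esphere) (A * enorm (x - z)));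
      last by rewrite Rintegral_sphere_cst.
  by apply: sphere_integralD => //;
    [exact: bounded_measurableZ|exact: bounded_measurable_cst].
rewrite poisson_one// mulr1 [leRHS]splitr lerD2l.
apply: (@le_trans _ _ ((A + 1) * enorm (x - z))).
  by rewrite ler_wpM2r ?enorm_ge0// lerDl.
by rewrite mulrC -ler_pdivlMr// ltW.
Qed.

End dirichlet.

(** * The sup norm over the ball *)

Section supnorm.
Context {R : realType} {n m : nat}.
Implicit Types (h : 'rV[R]_n -> 'rV[R]_m) (x : 'rV[R]_n) (C : R).

Lemma eball0 : eball (0 : 'rV[R]_n).
Proof. by rewrite /eball/= enorm0. Qed.

Lemma le_supnorm h C x : (forall y, eball y -> enorm (h y) <= C) -> eball x ->
  enorm (h x) <= supnorm h.
Proof.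
move=> hC bx; apply: ub_le_sup; last by exists x.
by exists C => _ [y By <-]; exact: hC.
Qed.

Lemma supnorm_cst h C : (forall x, eball x -> enorm (h x) = C) -> supnorm h = C.
Proof.
move=> hC; rewrite /supnorm (_ : [set _ | _ in _] = [set C]) ?sup1//.
apply/seteqP; split=> [_ [x bx <-]|_ ->]; first exact: hC.
by exists 0; [exact: eball0|rewrite hC//; exact: eball0].
Qed.

Lemma within_continuous_dot h (D : set 'rV[R]_n) (v : 'rV[R]_m) :
  {within D, continuous h} -> {within D, continuous (fun x => dot v (h x))}.
Proof.
move=> /subspace_continuousP ch; apply/subspace_continuousP => x Dx.
exact: (cvg_comp _ _ (ch x Dx) (@dot_continuous _ _ v (h x))).
Qed.

Lemma within_continuous_bounded h : {within ecball, continuous h} ->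
  exists C, forall x, ecball x -> enorm (h x) <= C.
Proof.
move=> /subspace_continuousP ch.
have ce : {within [set x | enorm x <= 1], continuous (fun x => enorm (h x))}.
  apply/subspace_continuousP => x Dx.
  exact: (cvg_comp _ _ (ch x Dx) (@enorm_continuous _ _ (h x))).
have [|c _ cmax] := EVT_max_rV _ (@compact_ball R n 1) ce.
  by exists 0; exact: ltW eball0.
by exists (enorm (h c)) => x x1; apply: cmax; rewrite inE.
Qed.

End supnorm.

(** * The sign of the last coordinate *)

Section hemisphere.
Context {R : realType} {n : nat}.
Hypothesis n_gt0 : (0 < n)%N.
Local Notation sigma := (@sphere_measure R n).
Local Notation north := (@north R n).
Implicit Types x z : 'rV[R]_n.

Definition hemisphere_sign z : R :=
  \1_upper_hemisphere z - \1_lower_hemisphere z.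

Lemma dot_north z (i : 'I_n) : i.+1 = n -> dot z north = z ord0 i.
Proof.
move=> iN; rewrite /dot (bigD1 i)//= mxE iN eqxx mulr1 big1 ?addr0// => j ji.
rewrite mxE; case: eqP => [jN|_]; last by rewrite mulr0.
by move: ji; rewrite -val_eqE/= -eqSS jN iN eqxx.
Qed.

Let last_ord : 'I_n := Ordinal (eq_leq (prednK n_gt0)).

Let last_ordS : last_ord.+1 = n. Proof. exact: prednK. Qed.

Lemma enorm_north : enorm north = 1.
Proof.
apply/eqP; rewrite -(@eqrXn2 _ 2) ?enorm_ge0// -dotE_enorm.
by rewrite (dot_north _ last_ordS) mxE last_ordS eqxx expr1n.
Qed.

Lemma upper_hemisphereE :
  upper_hemisphere = esphere `&` [set z | 0 <= dot z north].
Proof.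
apply/seteqP; split=> z [Sz h]; split=> //=.
  by rewrite (dot_north _ last_ordS) h.
by move=> i /dot_north <-.
Qed.

Lemma lower_hemisphereE :
  lower_hemisphere = esphere `&` [set z | dot z north <= 0].
Proof.
apply/seteqP; split=> z [Sz h]; split=> //=.
  by rewrite (dot_north _ last_ordS) h.
by move=> i /dot_north <-.
Qed.

Lemma hemisphere_signE z : esphere z ->
  hemisphere_sign z = Num.sg (dot z north).
Proof.
move=> Sz; rewrite /hemisphere_sign !indicE upper_hemisphereE lower_hemisphereE.
rewrite !in_setI (mem_set Sz) /=.
have -> : (z \in [set y | 0 <= dot y north]) = (0 <= dot z north).
  by apply/idP/idP => [/set_mem|/mem_set].
have -> : (z \in [set y | dot y north <= 0]) = (dot z north <= 0).
  by apply/idP/idP => [/set_mem|/mem_set].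
have [z0|z0|->] := ltgtP (dot z north) 0.
- by rewrite ltr0_sg// sub0r.
- by rewrite gtr0_sg// subr0.
- by rewrite sgr0 subrr.
Qed.

Lemma bounded_measurable_hemisphere_sign : bounded_measurable hemisphere_sign.
Proof.
have md : measurable_fun setT (fun z => dot z north : measurableTypeR R).
  rewrite (_ : (fun z => dot z north) = dot north); last first.
    by apply/funext => z; rewrite dotC.
  by apply: measurable_fun_continuous; exact: dot_continuous.
have mS := @measurable_esphere R n.
split.
  apply: measurable_funTS; apply: measurable_funB; apply: measurable_indic.
    rewrite upper_hemisphereE; apply: measurableI => //.
    rewrite -[X in measurable X]setTI (_ : [set z | _] = (fun z => dot z north)
      @^-1` `[0, +oo[).
      exact: md.
    by apply/seteqP; split=> z /=; rewrite in_itv/= andbT.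
  rewrite lower_hemisphereE; apply: measurableI => //.
  rewrite -[X in measurable X]setTI (_ : [set z | _] = (fun z => dot z north)
    @^-1` `]-oo, 0]).
    exact: md.
  by apply/seteqP; split=> z /=; rewrite in_itv/=.
by exists 1 => z Sz; rewrite hemisphere_signE// normr_sg lern1 leq_b1.
Qed.

(** The reflection across the equator changes the sign. *)
Lemma sphere_integral_hemisphere_sign :
  \int[sigma]_(z in esphere) hemisphere_sign z = 0.
Proof.
have bs := bounded_measurable_hemisphere_sign.
suff : \int[sigma]_(z in esphere) hemisphere_sign z
    = - \int[sigma]_(z in esphere) hemisphere_sign z by lra.
rewrite -[LHS](sphere_integral_reflect n_gt0 north)// -mulN1r
  -sphere_integralZ//.
apply: eq_Rintegral => z; rewrite inE => Sz.
rewrite !hemisphere_signE//; last by rewrite /esphere/= enorm_reflect.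
rewrite mulN1r -sgrN; congr Num.sg.
rewrite /reflect_along dotBl dotZl dotE_enorm enorm_north expr1n.
by rewrite divr1; ring.
Qed.

Lemma hemisphere_harmonicE x : eball x ->
  hemisphere_harmonic (enorm x *: north)
  = poisson hemisphere_sign (enorm x *: north).
Proof.
move=> bx; rewrite /hemisphere_harmonic; case: eqP => // xN.
have : enorm (enorm x *: north) = 1 by rewrite xN enorm_north.
rewrite enormZ enorm_north mulr1 ger0_norm ?enorm_ge0// => x1.
by move: bx; rewrite /eball/= x1 ltxx.
Qed.

(** The value of [poisson_kernel x] at the points [z] of the sphere orthogonal
    to [x], see [equator_valueE]: there [|x - z|^2 = 1 + |x|^2]. *)
Definition equator_value x : R :=
  (1 - enorm x ^+ 2) / (1 + enorm x ^+ 2) `^ (n%:R / 2).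

Lemma equator_valueE x :
  equator_value x = (1 - enorm x ^+ 2) / Num.sqrt (1 + enorm x ^+ 2) ^+ n.
Proof.
rewrite /equator_value; congr (_ / _).
have x0 : 0 <= 1 + enorm x ^+ 2 by rewrite addr_ge0// sqr_ge0.
by rewrite mulrC powRrM powR12_sqrt// powR_mulrn// sqrtr_ge0.
Qed.

(** The kernel decreases with [|y - z|], whose square is
    [1 + |y|^2 - 2 r (z.north)]: its excess over the equatorial value has the
    sign of the last coordinate of [z]. *)
Lemma normr_kernel_sub_equator (r : R) z : 0 <= r -> r < 1 -> esphere z ->
  let y := r *: north in
  `|poisson_kernel y z - equator_value y|
  = (poisson_kernel y z - equator_value y) * hemisphere_sign z.
Proof.
move=> r0 r1 Sz y; have yr : enorm y = r.
  by rewrite enormZ enorm_north mulr1 ger0_norm.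
have by_ : eball y by rewrite /eball/= yr.
have yz0 : 0 < enorm (y - z) by rewrite enorm_gt0 subr_eq0 eball_neq_esphere.
have D0 : 0 < Num.sqrt (1 + enorm y ^+ 2) by rewrite sqrtr_gt0 ltr_wpDr//
  sqr_ge0.
have yz : enorm (y - z) = Num.sqrt (1 + enorm y ^+ 2 - 2 * (r * dot z north)).
  rewrite -[LHS]ger0_norm ?enorm_ge0// -sqrtr_sqr; congr Num.sqrt.
  rewrite -(dotE_enorm (y - z)) dotBl !dotBr (dotC z y) !dotE_enorm Sz /y dotZl
    (dotC _ z).
  by ring.
have p0 : 0 <= 1 - enorm y ^+ 2 by rewrite subr_ge0 exprn_ile1 ?enorm_ge0// yr
  ltW.
rewrite hemisphere_signE// equator_valueE /poisson_kernel -mulrBr.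
have [z0|z0|z0] := ltgtP (dot z north) 0.
- rewrite ltr0_sg// mulrN1 ler0_norm// mulr_ge0_le0// subr_le0.
  rewrite lef_pV2 ?posrE ?exprn_gt0//.
  apply: lerXn2r; rewrite ?nnegrE ?sqrtr_ge0 ?enorm_ge0//.
  by rewrite yz ler_wsqrtr// lerDl oppr_ge0 mulr_ge0_le0// mulr_ge0_le0// ltW.
- rewrite gtr0_sg// mulr1 ger0_norm// mulr_ge0// subr_ge0.
  rewrite lef_pV2 ?posrE ?exprn_gt0//.
  apply: lerXn2r; rewrite ?nnegrE ?sqrtr_ge0 ?enorm_ge0//.
  by rewrite yz ler_wsqrtr// gerDl oppr_le0 mulr_ge0// mulr_ge0// ltW.
- by rewrite yz z0 !mulr0 subr0 subrr !mulr0 mul0r normr0.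
Qed.

(** The reflection that exchanges [x] and [|x| north] moves the pole of the
    hemispheres to the north. *)
Lemma sphere_integral_kernel_sub_equator x : eball x ->
  \int[sigma]_(z in esphere) `|poisson_kernel x z - equator_value x|
  = hemisphere_harmonic (enorm x *: north).
Proof.
move=> bx; rewrite hemisphere_harmonicE//; pose y := enorm x *: north.
have yx : enorm y = enorm x.
  by rewrite enormZ enorm_north mulr1 ger0_norm// enorm_ge0.
have by_ : eball y by rewrite /eball/= yx.
have cy : equator_value y = equator_value x by rewrite /equator_value yx.
have bs := bounded_measurable_hemisphere_sign.
have bk := bounded_measurable_kernel by_.
have bkc : bounded_measurable (fun z => poisson_kernel y z - equator_value x).
  by apply: bounded_measurableB => //; exact: bounded_measurable_cst.
transitivity
    (\int[sigma]_(z in esphere) `|poisson_kernel y z - equator_value x|).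
  have brefl := bounded_measurable_norm bkc.
  rewrite -[RHS](sphere_integral_reflect n_gt0 (x - y) brefl).
  apply: eq_Rintegral => z _; rewrite -(poisson_kernel_reflect (x - y) x z).
  by rewrite (reflect_swap (esym yx)).
transitivity (\int[sigma]_(z in esphere)
    (poisson_kernel y z * hemisphere_sign z
     - equator_value x * hemisphere_sign z)).
  apply: eq_Rintegral => z; rewrite inE => Sz; rewrite -mulrBl -cy.
  apply: normr_kernel_sub_equator => //; exact: enorm_ge0.
have bks := bounded_measurableM bk bs.
have bcs := bounded_measurableZ (equator_value x) bs.
rewrite (sphere_integralB n_gt0 bks bcs) (sphere_integralZ n_gt0 _ bs).
by rewrite sphere_integral_hemisphere_sign mulr0 subr0.
Qed.

(** A Schwarz lemma.  The left-hand side is the integral of [phi] against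
    [poisson_kernel x - equator_value x], whose absolute value is integrated in
    [sphere_integral_kernel_sub_equator]. *)
Lemma poisson_sub_equator_le (phi : 'rV[R]_n -> R) S x :
  bounded_measurable phi -> (forall z, esphere z -> `|phi z| <= S) -> eball x ->
  poisson phi x - equator_value x * poisson phi 0
  <= S * hemisphere_harmonic (enorm x *: north).
Proof.
move=> bphi phiS bx; pose c := equator_value x; rewrite -/c.
have bk := bounded_measurable_kernel bx.
have bkphi := bounded_measurableM bk bphi.
have bcphi := bounded_measurableZ c bphi.
have bkc : bounded_measurable (fun z => `|poisson_kernel x z - c|).
  apply: bounded_measurable_norm; apply: bounded_measurableB => //.
  exact: bounded_measurable_cst.
have bSkc := bounded_measurableZ S bkc.
rewrite -(sphere_integral_kernel_sub_equator bx) -/c.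
rewrite -(sphere_integralZ n_gt0 S bkc) poisson0.
rewrite -(sphere_integralZ n_gt0 c bphi) /poisson.
rewrite -(sphere_integralB n_gt0 bkphi bcphi).
apply: (le_sphere_integral n_gt0 (bounded_measurableB bkphi bcphi) bSkc) =>
  z Sz.
rewrite -mulrBl (le_trans (ler_norm _))// normrM mulrC.
apply: ler_wpM2r; [exact: normr_ge0|exact: phiS].
Qed.

End hemisphere.

(** * The two estimates *)

Section boundary_data.
Context {R : realType} {n m : nat}.
Hypothesis n_gt0 : (0 < n)%N.
Local Notation sigma := (@sphere_measure R n).
Local Notation north := (@north R n).
Variable f : 'rV[R]_n -> 'rV[R]_m.
Hypothesis cf : {within ecball, continuous f}.
Implicit Types (x z : 'rV[R]_n) (v : 'rV[R]_m).

Let cfS : {within esphere, continuous f}.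
Proof.
apply: continuous_subspaceW cf => x.
by rewrite /esphere/ecball/= => ->.
Qed.

Lemma bounded_measurable_dot v : bounded_measurable (fun z => dot v (f z)).
Proof.
split.
  apply: measurable_fun_within; first exact: measurable_esphere.
  exact: within_continuous_dot.
have [C fC] := within_continuous_bounded cf.
exists (enorm v * C) => z Sz; rewrite (le_trans (normr_dot_le _ _))//.
by rewrite ler_wpM2l ?enorm_ge0// fC// /ecball/= Sz.
Qed.

Lemma dot_poisson_vec v x : eball x ->
  dot v (poisson_vec f x) = poisson (fun z => dot v (f z)) x.
Proof.
move=> bx; have bk := bounded_measurable_kernel bx.
have bj j : bounded_measurable (fun z => poisson_kernel x z * f z ord0 j).
  apply: bounded_measurableM => //.
  have -> : (fun z => f z ord0 j) = (fun z => dot (delta_mx ord0 j) (f z)).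
    by apply/funext => z; rewrite dotC dot_delta.
  exact: bounded_measurable_dot.
rewrite /dot /poisson.
transitivity (\int[sigma]_(z in esphere)
    (\sum_(j < m) v ord0 j * (poisson_kernel x z * f z ord0 j))).
  rewrite sphere_integral_sum//; last by move=> j; exact: bounded_measurableZ.
  by apply: eq_bigr => j _; rewrite mxE sphere_integralZ.
apply: eq_Rintegral => z _; rewrite mulr_sumr.
by apply: eq_bigr => j _; ring.
Qed.

Lemma poisson_vec_bounded :
  exists C, forall x, eball x -> enorm (poisson_vec f x) <= C.
Proof.
have [C fC] := within_continuous_bounded cf.
exists C => x bx; apply: enorm_le_dot => v v1; rewrite dot_poisson_vec//.
have bk := bounded_measurable_kernel bx; have bC := @bounded_measurable_cst R n
  C.
apply: (@le_trans _ _ (\int[sigma]_(z in esphere) (C * (poisson_kernel x z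
  * 1)))).
  apply: le_sphere_integral => //.
  - by apply: bounded_measurableM => //; exact: bounded_measurable_dot.
  - by apply: bounded_measurableZ; apply: bounded_measurableM => //;
    exact: bounded_measurable_cst.
  - move=> z Sz; rewrite mulr1 mulrC ler_wpM2r ?poisson_kernel_ge0//;
    first exact: ltW.
    have z1 : ecball z by rewrite /ecball/= Sz.
    have C0 : 0 <= C := le_trans (enorm_ge0 _) (fC _ z1).
    rewrite (le_trans (dot_le_enorm _ _))// -[leRHS]mul1r ler_pM ?enorm_ge0//.
    exact: fC.
rewrite sphere_integralZ//; last by apply: bounded_measurableM => //;
  exact: bounded_measurable_cst.
by rewrite -/(poisson (fun=> 1) x) poisson_one// mulr1.
Qed.

Lemma poisson_vec_le_supnorm x : eball x ->
  enorm (poisson_vec f x) <= supnorm (poisson_vec f).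
Proof. by have [C hC] := poisson_vec_bounded => bx;
  exact: le_supnorm hC bx. Qed.

Lemma eball_approach z (d : R) : esphere z -> 0 < d ->
  exists2 x, eball x & enorm (x - z) < d.
Proof.
move=> Sz d0; pose t := Order.min 1 (d / 2).
have t0 : 0 < t by rewrite lt_min ltr01 divr_gt0.
have t1 : t <= 1 by rewrite ge_min lexx.
have td : t < d by rewrite gt_min; apply/orP; right; lra.
exists ((1 - t) *: z).
  by rewrite /eball/= enormZ Sz mulr1 ger0_norm ?subr_ge0// ltrBlDr ltrDl.
rewrite scalerBl scale1r addrAC subrr add0r enormN enormZ Sz mulr1.
by rewrite gtr0_norm.
Qed.

(** The Poisson integral attains its boundary values, so its sup norm controls
    the boundary data. *)
Lemma sphere_le_supnorm z : esphere z -> enorm (f z) <= supnorm (poisson_vec f).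
Proof.
move=> Sz; apply: enorm_le_dot => v v1; apply/ler_addgt0Pr => e e0.
have [d d0 dP] := poisson_boundary n_gt0 (bounded_measurable_dot v)
  (within_continuous_dot (v := v) cfS) Sz e0.
have [x bx xz] := eball_approach Sz d0.
have := dP x bx xz; rewrite -dot_poisson_vec// ler_distlC => /andP[_ h].
have h' : dot v (poisson_vec f x) <= supnorm (poisson_vec f).
  rewrite (le_trans (dot_le_enorm _ _))// -[leRHS]mul1r.
  by rewrite ler_pM ?enorm_ge0// poisson_vec_le_supnorm.
by apply: le_trans h _; rewrite lerD2r.
Qed.

Lemma poisson_vec_schwarz x : eball x ->
  enorm (poisson_vec f x - equator_value x *: poisson_vec f 0)
  <= supnorm (poisson_vec f) * hemisphere_harmonic (enorm x *: north).
Proof.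
move=> bx; apply: enorm_le_dot => v v1; rewrite dotBr dotZr.
rewrite (dot_poisson_vec v bx) (dot_poisson_vec v eball0).
apply: (poisson_sub_equator_le n_gt0 (bounded_measurable_dot v)) => // z Sz.
rewrite (le_trans (normr_dot_le _ _))// -[leRHS]mul1r.
apply: ler_pM; [exact: enorm_ge0|exact: enorm_ge0|exact: v1|].
exact: sphere_le_supnorm.
Qed.

Variable g : 'rV[R]_n -> 'rV[R]_m.
Hypotheses (cg : {within ecball, continuous g}) (f2 : Ck 2 eball f)
  (fg : forall x, eball x -> laplacian f x = g x).

Let g_le_supnorm x : eball x -> enorm (g x) <= supnorm g.
Proof.
have [C gC] := within_continuous_bounded cg.
by move=> bx; apply: (@le_supnorm _ _ _ g C) => // y /ltW; exact: gC.
Qed.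

(** [f] minus its Poisson integral vanishes on the sphere and its Laplacian is
    at most [supnorm g] in any direction; adding a multiple of [|x|^2 - 1]
    makes it subharmonic. *)
Lemma sub_poisson_vec_le x : eball x ->
  enorm (f x - poisson_vec f x) <= supnorm g / (2 * n%:R) * (1 - enorm x ^+ 2).
Proof.
move=> bx; apply: enorm_le_dot => v v1; rewrite dotBr dot_poisson_vec//.
set phi := fun z => dot v (f z).
have bphi : bounded_measurable phi := bounded_measurable_dot v.
pose G := supnorm g; pose a := G / (2 * n%:R).
(* [d] is the difference, extended by its boundary value 0. *)
pose d y := if enorm y < 1 then phi y - poisson phi y else 0.
pose w y := d y + a * (enorm y ^+ 2 - 1).
suff : w x <= 0.
  rewrite /w /d; move: (bx); rewrite /eball/= => ->; rewrite -/G -/a.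
  by rewrite /phi; lra.
have n0 : 0 < n%:R :> R by rewrite ltr0n.
have cphi : {within ecball, continuous phi} by exact: within_continuous_dot.
have cphiP := (within_continuous_enormP _ _).1 cphi.
have cd : {within ecball, continuous d}.
  apply/within_continuous_enormP => y /ecballE[By|Sy] e e0.
    have e20 : 0 < e / 2 by rewrite divr_gt0.
    have [d1 d10 h1] := cphiP y (ltW By) _ e20.
    have [d2 d20 h2] := (continuous_enormP _ _).1 (poisson_continuous n_gt0
      bphi By) _ e20.
    exists (Order.min (half_gap y) (Order.min d1 d2)).
      by rewrite !lt_min half_gap_gt0// d10.
    move=> u u1; rewrite !lt_min => /andP[uy /andP[ud1 ud2]].
    have [bu _] := near_eball By (ltW uy).
    rewrite /d; move: (By) (bu); rewrite /eball/= => -> ->.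
    rewrite (_ : phi u - poisson phi u - (phi y - poisson phi y)
      = (phi u - phi y) - (poisson phi u - poisson phi y)); last by ring.
    rewrite (le_lt_trans (ler_normB _ _))// [e]splitr ltrD//;
      [exact: h1|exact: h2].
  have e20 : 0 < e / 4 by rewrite divr_gt0.
  have y1 : ecball y by rewrite /ecball/= Sy.
  have [d1 d10 h1] := cphiP y y1 _ e20.
  have [d2 d20 h2] := poisson_boundary n_gt0 bphi (within_continuous_dot
    (v := v) cfS) Sy e20.
  exists (Order.min d1 d2); first by rewrite lt_min d10.
  move=> u u1; rewrite lt_min => /andP[ud1 ud2].
  rewrite /d [in X in _ - X]Sy ltxx subr0; case: ifPn => [bu|_];
    last by rewrite normr0.
  rewrite (_ : _ - _ = (phi u - phi y) - (poisson phi u - phi y)); last by ring.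
  rewrite (le_lt_trans (ler_normB _ _))//.
  have k1 := h1 u u1 ud1; have k2 := h2 u bu ud2; rewrite /phi in k1 k2 *; lra.
apply: (maximum_principle n_gt0 (w := w) (r := 1)) => //; last exact: ltW.
- apply/subspace_continuousP => y y1; apply: cvgD.
    by move/subspace_continuousP : cd; exact.
  apply: cvg_within_filter.
  apply: (@continuous_comp _ _ _ (@enorm R n) (fun s : R => a * (s ^+ 2 - 1)));
    first exact: enorm_continuous.
  by apply: cvgMl_tmp; apply: cvgB; [exact: exprn_continuous|exact: cvg_cst].
- move=> y By; exists (dot v (g y) + -1 * 0 + a * (2 * n%:R)).
    rewrite mulr0 addr0 /a divfK ?gt_eqF ?mulr_gt0//.
    have : `|dot v (g y)| <= G.
      rewrite (le_trans (normr_dot_le _ _))// -[leRHS]mul1r.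
      by rewrite ler_pM ?enorm_ge0// g_le_supnorm.
    by rewrite ler_norml; lra.
  apply: (@near_has_laplacian _ _ (fun u => (phi u + -1 * poisson phi u)
    + a * (enorm u ^+ 2 - 1)) _ _ _ (half_gap y)).
  + exact: half_gap_gt0.
  + move=> u /ltW uy; have [bu _] := near_eball By uy.
    by rewrite /w /d; move: bu; rewrite /eball/= => ->; rewrite mulN1r.
  + apply: has_laplacianD; last first.
      by apply: has_laplacianZ; exact: has_laplacian_sqr_enorm.
    apply: has_laplacianD; last first.
      by apply: has_laplacianZ; exact: poisson_has_laplacian.
    by rewrite -fg//; exact: Ck2_has_laplacian.
- by move=> z z1; rewrite /w /d z1 ltxx expr1n subrr mulr0 addr0.
Qed.

Lemma poisson_equation_bound x : ecball x ->
  enorm (f x - equator_value x *: poisson_vec f 0)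
  <= supnorm (poisson_vec f) * hemisphere_harmonic (enorm x *: north)
     + supnorm g / (2 * n%:R) * (1 - enorm x ^+ 2).
Proof.
move=> /ecballE[bx|Sx].
  rewrite -(subrK (poisson_vec f x) (f x)) -addrA (le_trans (ler_enormD _ _))//.
  by rewrite [leRHS]addrC lerD//;
    [exact: sub_poisson_vec_le|exact: poisson_vec_schwarz].
rewrite /equator_value Sx expr1n subrr mul0r scale0r subr0 mulr0 addr0.
by rewrite scale1r /hemisphere_harmonic eqxx mulr1 sphere_le_supnorm.
Qed.

End boundary_data.

(** * The extremal example *)

Section paraboloid.
Context {R : realType} {n m : nat}.
Implicit Types (x : 'rV[R]_n) (a : 'rV[R]_m) (q : 'rV[R]_n -> R).

Lemma line_derive_scale q x (i : 'I_n) l a : line_derive q x i l ->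
  is_derive x (delta_mx ord0 i) (fun y => q y *: a) (l *: a).
Proof.
move=> [qd ql].
have ql' : (fun h : R => h^-1 * (q (row_line x i (h * 1 + 0)) - q (row_line x i
  0))) @ 0^' --> l.
  by rewrite -ql; exact: qd.
have qa : (fun h : R => h^-1 *: (q (h *: delta_mx ord0 i + x) *: a - q x *: a))
  @ 0^' --> l *: a.
  have : (fun h : R => (h^-1 * (q (row_line x i (h * 1 + 0)) - q (row_line x i
    0))) *: a) @ 0^' --> l *: a.
    exact: cvgZr_tmp.
  apply: cvg_trans; apply: near_eq_cvg; apply: nearW => h.
  by rewrite -scalerBl scalerA mulr1 addr0 row_line0 /row_line (addrC x).
apply: DeriveDef; first by apply/cvg_ex; exists (l *: a).
exact/cvg_lim.
Qed.

(** The extremal functions are prescribed on the closed ball only; that is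
    enough for their derivatives in the open ball. *)
Lemma eball_partial (h : 'rV[R]_n -> 'rV[R]_m) q a i l x :
  (forall y, eball y -> h y = q y *: a) -> eball x -> line_derive q x i l ->
  is_derive x (delta_mx ord0 i) h (l *: a).
Proof.
move=> hq bx ql; apply: near_eq_is_derive (line_derive_scale a ql).
by near=> y; rewrite hq//; near: y; exact: open_eball.
Unshelve. all: by end_near. Qed.

Lemma eball_continuous (h : 'rV[R]_n -> 'rV[R]_m) q a x :
  (forall y, eball y -> h y = q y *: a) -> eball x -> {for x, continuous q} ->
  {for x, continuous h}.
Proof.
move=> hq bx cq; suff : h @ x --> q x *: a by rewrite -hq.
apply: cvg_trans (continuousZr_tmp (a := a) cq).
apply: (@near_eq_cvg _ _ (nbhs x) (@nbhs_filter _ x)).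
by apply: filterS (open_eball bx) => y /hq ->.
Qed.

End paraboloid.

Section extremal.
Context {R : realType} {n m : nat}.
Variables (M : R) (f g : 'rV[R]_n -> 'rV[R]_m).
Hypotheses (hm : (0 < m)%N) (n_gt0 : (0 < n)%N) (M0 : 0 < M).
Local Notation e1 := (@first_vec R m).
Hypothesis gE : forall x, ecball x -> g x = (- (2 * n%:R * M)) *: e1.
Hypothesis fE : forall x, ecball x -> f x = (M * (1 - enorm x ^+ 2)) *: e1.

Lemma enorm_first_vec : enorm e1 = 1.
Proof.
rewrite (_ : e1 = delta_mx ord0 (Ordinal hm)) ?enorm_delta//.
by apply/rowP => i; rewrite !mxE eqxx.
Qed.

Let fb x : eball x -> f x = (M * (1 - enorm x ^+ 2)) *: e1.
Proof. by move/ltW; exact: fE. Qed.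

Let fd x i : eball x ->
  is_derive x (delta_mx ord0 i) f ((M * - (2 * x ord0 i)) *: e1).
Proof.
move=> bx; apply: (eball_partial fb bx).
by apply: line_deriveZ; exact: line_derive_one_sub_sqr.
Qed.

Let pfE i x : eball x -> partial i f x = (M * (-2) * x ord0 i) *: e1.
Proof.
by move=> bx; rewrite /partial; have [_ ->] := fd i bx; congr (_ *: _); ring.
Qed.

Let fdd x i j : eball x ->
  is_derive x (delta_mx ord0 j) (partial i f) ((M * (-2) * (i == j)%:R) *: e1).
Proof.
move=> bx; apply: (eball_partial (pfE i) bx); apply: line_deriveZ.
exact: line_derive_coord.
Qed.

Let ppfE i j x : eball x ->
  partial j (partial i f) x = (M * (-2) * (i == j)%:R) *: e1.
Proof. by move=> bx; rewrite {1}/partial; have [_ ->] := fdd i j bx. Qed.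

Lemma paraboloid_solves_poisson : solves_poisson f g.
Proof.
have cq x : {for x, continuous (fun y : 'rV[R]_n => M * (1 - enorm y ^+ 2))}.
  apply: (@continuous_comp _ _ _ (@enorm R n) (fun r : R => M * (1 - r ^+ 2)));
    first exact: enorm_continuous.
  by apply: cvgMl_tmp; apply: cvgB; [exact: cvg_cst|exact: exprn_continuous].
split.
- apply: (subspace_eq_continuous (f := fun=> (- (2 * n%:R * M)) *: e1)).
    by move=> x; rewrite inE => /gE.
  by apply: continuous_subspaceT => x; exact: cst_continuous.
- apply: (subspace_eq_continuous (f := fun x => (M * (1 - enorm x ^+ 2)) *:
  e1)).
    by move=> x; rewrite inE => /fE.
  by apply: continuous_subspaceT => x;
    exact: (continuousZr_tmp (a := e1) (cq x)).
- split=> [x bx|i]; first by apply: (eball_continuous fb bx); exact: cq.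
  split=> [x /(fd i)[]//|]; split=> [x bx|j].
    apply: (eball_continuous (pfE i) bx).
    apply: (@continuous_comp _ _ _ (fun y : 'rV[R]_n => y ord0 i) (fun r : R =>
      M * (-2) * r)); first exact: coord_continuous.
    exact: mulrl_continuous.
  split=> [x /(fdd i j)[]//|]; split=> // x bx.
  apply: (eball_continuous (q := fun=> M * (-2) * (i == j)%:R) (ppfE i j) bx).
  exact: cst_continuous.
- move=> x bx; rewrite gE; last exact: ltW.
  rewrite /laplacian (eq_bigr (fun=> (M * (-2)) *: e1)).
    rewrite sumr_const card_ord scalerMnl; congr (_ *: _).
    by rewrite -mulr_natr; ring.
  by move=> i _; rewrite ppfE// eqxx mulr1.
Qed.

Lemma paraboloid_equality x : ecball x ->
  enorm (f x - equator_value x *: poisson_vec f 0)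
  = supnorm (poisson_vec f) * hemisphere_harmonic (enorm x *: @north R n)
    + supnorm g / (2 * n%:R) * (1 - enorm x ^+ 2).
Proof.
move=> x1; have Pf y : poisson_vec f y = 0.
  apply/rowP => j; rewrite !mxE /poisson.
  transitivity (\int[@sphere_measure R n]_(z in esphere) (0 : R)).
    apply: eq_Rintegral => z; rewrite inE => Sz.
    rewrite fE; last by rewrite /ecball/= Sz.
    by rewrite Sz expr1n subrr mulr0 scale0r mxE mulr0.
  by rewrite Rintegral_sphere_cst.
have n0 : 0 < n%:R :> R by rewrite ltr0n.
rewrite (supnorm_cst (C := 0)); last by move=> y _; rewrite Pf enorm0.
rewrite (supnorm_cst (C := 2 * n%:R * M)); last first.
  move=> y /ltW/gE ->; rewrite enormZ enorm_first_vec mulr1 normrN ger0_norm//.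
  by rewrite !mulr_ge0// ltW.
rewrite Pf scaler0 subr0 mul0r add0r fE// enormZ enorm_first_vec mulr1.
rewrite ger0_norm; last first.
  by rewrite mulr_ge0 ?(ltW M0)// subr_ge0 exprn_ile1// enorm_ge0.
by congr (_ * _); field; rewrite gt_eqF.
Qed.

End extremal.

(** * The estimate and its sharpness *)

Unset Implicit Arguments.

Theorem theorem1 (R : realType) (n m : nat) (hn : (3 <= n)%N) (hm : (1 <= m)%N) :
  (forall f g : 'rV[R]_n -> 'rV[R]_m, solves_poisson f g ->
     forall x : 'rV[R]_n, ecball x ->
       enorm (f x - ((1 - enorm x ^+ 2) / (1 + enorm x ^+ 2) `^ (n%:R / 2))
                      *: poisson_vec f 0)
       <= supnorm (poisson_vec f) * hemisphere_harmonic (enorm x *: @north R n)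
          + supnorm g / (2 * n%:R) * (1 - enorm x ^+ 2))
  /\
  (forall M : R, 0 < M ->
     forall f g : 'rV[R]_n -> 'rV[R]_m,
       (forall x, ecball x -> g x = (- (2 * n%:R * M)) *: first_vec) ->
       (forall x, ecball x -> f x = (M * (1 - enorm x ^+ 2)) *: first_vec) ->
       solves_poisson f g /\
       forall x : 'rV[R]_n, esphere x \/ x = 0 ->
         enorm (f x - ((1 - enorm x ^+ 2) / (1 + enorm x ^+ 2) `^ (n%:R / 2))
                        *: poisson_vec f 0)
         = supnorm (poisson_vec f) * hemisphere_harmonic (enorm x *: @north R n)
           + supnorm g / (2 * n%:R) * (1 - enorm x ^+ 2)).
Proof.
have n_gt0 : (0 < n)%N by exact: leq_trans hn.
split=> [f g [cg cf f2 fg] x|M M0 f g gE fE].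
  exact: poisson_equation_bound.
split=> [|x xS]; first exact: (paraboloid_solves_poisson gE fE).
apply: (paraboloid_equality hm n_gt0 M0 gE fE); apply/ecballE.
by case: xS => [|->]; [right|left; exact: eball0].
Qed.
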